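(* Let $\Bbbk$ be a field, let $R=\Bbbk[x_1,\dots,x_N]$, and let $I=(f_0,f_1,\dots,f_k)\subseteq R$ with all $f_i$ homogeneous of degree $r$. Let $\mathcal R(I)=S/L$ be the Rees algebra of $I$, presented as a quotient of $S=\Bbbk[x_1,\dots,x_N,w_0,\dots,w_k]$ with bigrading $\deg(x_i)=(1,0)$ and $\deg(w_i)=(0,1)$. Then for all homological indices $i\ge 0$, all integers $j$, and all integers $d\ge 0$, $$\beta_{i,\,j+rd}(I^d)\le\sum_{m=0}^d\binom{d+k-m}{d-m}\,\beta_{i,(j,m)}(\mathcal R(I)).$$
   Context: $R$ has the standard grading $\deg x_i=1$. For a homogeneous ideal $J\subseteq R$, $\beta_{i,j}(J)=\dim_{\Bbbk}\operatorname{Tor}_i^R(\Bbbk,J)_j$ are the graded Betti numbers of $J$ as an $R$-module (not of $R/J$); by convention $I^0=R$. The Rees algebra of $I$ is $\mathcal R(I)=R\oplus It\oplus I^2t^2\oplus\cdots\subseteq R[t]$. It is presented as $\mathcal R(I)=S/L$, where $L$ (the Rees ideal of $I$) is the kernel of the $R$-algebra homomorphism $S=R[w_0,\dots,w_k]\to R[t]$, $w_i\mapsto f_it$. Since all $f_i$ are homogeneous of the same degree, $L$ is bihomogeneous for the bigrading $\deg(x_i)=(1,0)$, $\deg(w_i)=(0,1)$, so $\mathcal R(I)=S/L$ is a bigraded $S$-module. The bigraded Betti numbers $\beta_{i,(j,m)}(\mathcal R(I))=\dim_{\Bbbk}\operatorname{Tor}^S_i(\Bbbk,\mathcal R(I))_{(j,m)}$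 are the multiplicities of $S(-j,-m)$ in the $i$-th module of the minimal bigraded free resolution of $\mathcal R(I)$ over $S$. *)

(* Defs.v *)
From mathcomp Require Import all_boot all_order all_algebra.
From mathcomp Require Import mpoly.

Set Implicit Arguments.
Unset Strict Implicit.
Unset Printing Implicit Defensive.

Import GRing.Theory.
Local Open Scope ring_scope.

Section Ideals.
Variable A : comNzRingType.

Definition ideal_gen (n : nat) (f : 'I_n -> A) (p : A) : Prop :=
  exists g : 'I_n -> A, p = \sum_(i < n) g i * f i.

Definition ideal_mul (P Q : A -> Prop) (p : A) : Prop :=
  exists (n : nat) (a b : 'I_n -> A),
    [/\ forall i, P (a i), forall i, Q (b i) & p = \sum_(i < n) a i * b i].

Fixpoint ideal_exp (P : A -> Prop) (d : nat) : A -> Prop :=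
  if d is d'.+1 then ideal_mul P (ideal_exp P d') else fun _ => True.

End Ideals.

Section GradedResolutions.
Variables (K : fieldType) (n : nat) (G : zmodType) (wt : 'I_n -> G).
Local Notation A := {mpoly K[n]}.

Definition wdeg (m : 'X_{1..n}) : G := \sum_(i < n) wt i *+ m i.

(* [0] is homogeneous of every degree, as for [dhomog]. *)
Definition whomog (g : G) (p : A) : bool :=
  all [pred m | wdeg m == g] (msupp p).

(* Data ... -> F_1 -> F_0 -> A with F_i = \bigoplus_a A(- gf_shift i a), so that
   the a-th basis vector of F_i sits in degree gf_shift i a.  Elements of F_i
   are row vectors, and the maps multiply them on the right. *)
Record graded_free := GradedFree {
  gf_rank : nat -> nat;
  gf_shift : forall i, 'I_(gf_rank i) -> G;
  gf_diff : forall i, 'M[A]_(gf_rank i.+1, gf_rank i);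
  gf_aug : 'cV[A]_(gf_rank 0)
}.

(* F is a G-graded free resolution of the graded A-module P / Q, where Q and P
   are homogeneous ideals of A; the augmentation F_0 -> P / Q is given through
   a homogeneous lift F_0 -> A.  Ideals of A are the case Q = 0, and cyclic
   modules are the case P = A. *)
Definition graded_resolution (P Q : A -> Prop) (F : graded_free) : Prop :=
  [/\ forall a, whomog (gf_shift a) (gf_aug F a 0),
      forall i a b, whomog (gf_shift a - gf_shift b) (gf_diff F i a b),
      forall p, P p <->
        exists v : 'rV[A]_(gf_rank F 0), Q (p - (v *m gf_aug F) 0 0),
      forall v : 'rV[A]_(gf_rank F 0),
        Q ((v *m gf_aug F) 0 0) <-> exists u, v = u *m gf_diff F 0
    & forall i (v : 'rV[A]_(gf_rank F i.+1)),
        v *m gf_diff F i = 0 <-> exists u, v = u *m gf_diff F i.+1].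

(* The differentials of K \otimes_A F, where K = A / (variables): each entry is
   replaced by its constant term. *)
Definition res_diff (F : graded_free) (i : nat) :
    'M[K]_(gf_rank F i.+1, gf_rank F i) :=
  map_mx (mcoeff 0%MM) (gf_diff F i).

(* Row space: the degree-g component of K \otimes_A F_i. *)
Definition res_comp (F : graded_free) (i : nat) (g : G) : 'M[K]_(gf_rank F i) :=
  diag_mx (\row_a (gf_shift a == g)%:R).

Definition res_cycles (F : graded_free) (i : nat) : 'M[K]_(gf_rank F i) :=
  match i with 0 => 1%:M | i'.+1 => kermx (res_diff F i') end.

(* dim_K H_i(K \otimes_A F)_g.  When F is a graded free resolution of M this is
   dim_K Tor_i^A(K, M)_g, i.e. the graded Betti number beta_{i,g}(M).  The
   boundaries are contained in the cycles, so the subtraction does not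
   truncate. *)
Definition tor_dim (F : graded_free) (i : nat) (g : G) : nat :=
  (\rank (res_cycles F i :&: res_comp F i g)%MS
   - \rank (res_diff F i :&: res_comp F i g)%MS)%N.

End GradedResolutions.

Definition std_wt (N : nat) : 'I_N -> int := fun _ => 1.

(* The variables of S are x_1, ..., x_N followed by w_0, ..., w_k. *)
Definition rees_wt (N k : nat) (v : 'I_(N + k.+1)) : int * int :=
  match split v with inl _ => (1, 0) | inr _ => (0, 1) end.

Section Rees.
Variables (K : fieldType) (N k : nat) (f : 'I_k.+1 -> {mpoly K[N]}).

(* S -> R[t], x_i |-> x_i, w_j |-> f_j t. *)
Definition rees_map (p : {mpoly K[N + k.+1]}) : {poly {mpoly K[N]}} :=
  mmap (fun c : K => (c%:MP_[N])%:P)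
       (fun v => match split v with
                 | inl i => ('X_i)%:P
                 | inr j => f j *: 'X
                 end) p.

Definition rees_ideal (p : {mpoly K[N + k.+1]}) : Prop := rees_map p = 0.

End Rees.

(* Main.v *)
Require Import Defs.
From HB Require Import structures.
From mathcomp Require Import all_boot all_order all_algebra.
From mathcomp Require Import mpoly.
From Stdlib Require Import IndefiniteDescription.

Set Implicit Arguments.
Unset Strict Implicit.
Unset Printing Implicit Defensive.

Import Order.TTheory GRing.Theory Num.Theory.
Local Open Scope ring_scope.

(** Write R = K[x] and S = K[x, w], and let F be a bigraded free resolution of the
    Rees algebra of I over S.  The component of w-degree d of S(-a, -m) is a free
    R-module on the monomials of degree d - m in w, and taking this component is
    exact.  Hence the component of w-degree d of F, here [strand], is a graded
    free resolution over R of the component of w-degree d of the Rees algebra,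
    which is I^d with degrees lowered by r d ([strand_resolution]).  Any two
    graded free resolutions of I^d are homotopy equivalent, so that the Betti
    numbers of I^d may be computed from the strand ([tor_dim_resolution_leq]).

    If F were minimal, the Betti numbers of I^d would be bounded by the ranks of
    the strand, and the inequality would be a count of monomials.  For an
    arbitrary F the homology of the strand modulo x has to be bounded by that of
    F modulo x and w.  Its basis consists of the w^u e_b, and modulo x its
    differentials are block triangular for the exponents u; the diagonal block
    at u is a copy of the differential of F modulo x and w, in w-degree d - |u|.
    The rank of a block triangular matrix is at least the sum of the ranks of its
    diagonal blocks ([rank_block_triangular]), so by rank-nullity the Tor of the
    strand in degree j + r d is at most the sum over u of the Tor of F in degree
    (j, d - |u|) ([tor_dim_strand_leq]).  This is the spectral sequence of the
    w-adic filtration, reduced to ranks.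

    It remains to count the u of given degree, and to discard those with |u| > d:
    as F may have generators of negative w-degree, this uses that Tor itself
    vanishes there, the identity of F being null-homotopic in negative w-degrees
    ([tor_dim_rees_neg]).  Both this vanishing and the independence of the
    resolution are instances of [nullhomotopy]. *)

(** * Ranks of block triangular matrices *)
Section BlockTriangularRank.
Variable K : fieldType.

Lemma rank_mxsub_le m n m' n' (f : 'I_m' -> 'I_m) (g : 'I_n' -> 'I_n)
  (M : 'M[K]_(m, n)) : (\rank (mxsub f g M) <= \rank M)%N.
Proof.
have -> : mxsub f g M = rowsub f (colsub g M) by apply/matrixP=> a b; rewrite !mxE.
apply: leq_trans (mxrankS (rowsub_sub _ _)) _.
rewrite -mxrank_tr -[leqRHS]mxrank_tr.
have -> : (colsub g M)^T = rowsub g M^T by apply/matrixP=> a b; rewrite !mxE.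
exact: mxrankS (rowsub_sub _ _).
Qed.

Lemma full_rank_minor m n (M : 'M[K]_(m, n)) :
  exists (f : 'I_(\rank M) -> 'I_m) (g : 'I_(\rank M) -> 'I_n),
    mxsub f g M \in unitmx.
Proof.
have frA := maxrowsub_free M; set A := rowsub _ M in frA.
have fuA : row_full A^T by rewrite /row_full mxrank_tr.
exists (maxrankfun M), (fullrankfun fuA).
have := fullrowsub_unit fuA; rewrite -unitmx_tr.
by congr (_ \in unitmx); apply/matrixP=> a b; rewrite !mxE.
Qed.

(** Semicontinuity of the rank: scaling row [a] by t^(- p a) and column [b] by
    t^(q b) deforms [M] into a family polynomial in [t], of constant rank for
    t <> 0, whose value at t = 0 keeps only the entries with p a = q b. *)
Lemma rank_initial_part m n (p : 'I_m -> nat) (q : 'I_n -> nat)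
    (M : 'M[K]_(m, n)) :
    (forall a b, M a b != 0 -> (p a <= q b)%N) ->
  (\rank (\matrix_(a, b) (M a b *+ (p a == q b))) <= \rank M)%N.
Proof.
move=> tri; set M0 := \matrix_(a, b) _.
have [f [g unit0]] := full_rank_minor M0.
pose Mt := \matrix_(a, b) ((M (f a) (g b))%:P * 'X^(q (g b) - p (f a))).
(* The chosen minor of the initial part is the value at 0 of that of the family. *)
have Mt0 : \det (mxsub f g M0) = (\det Mt).[0].
  rewrite -horner_evalE -det_map_mx; congr (\det _).
  apply/matrixP=> a b; rewrite !mxE /= /horner_eval hornerM hornerC hornerXn.
  have [-> | /tri] := eqVneq (M (f a) (g b)) 0; first by rewrite mul0rn mul0r.
  by rewrite expr0n subn_eq0 mulr_natr eqn_leq => ->.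
suff : mxsub f g M \in unitmx.
  by move/mxrank_unit=> {1}<-; apply: rank_mxsub_le.
move: unit0; rewrite !unitmxE !unitfE; apply: contraNneq => detM0.
have eqD : diag_mx (\row_a 'X^(p (f a))) *m Mt
    = map_mx polyC (mxsub f g M) *m diag_mx (\row_b 'X^(q (g b))).
  apply/matrixP=> a b; rewrite mul_diag_mx mul_mx_diag !mxE.
  have [-> | /tri leq_pq] := eqVneq (M (f a) (g b)) 0; first by rewrite !mul0r mulr0.
  by rewrite mulrCA -exprD subnKC.
have := congr1 determinant eqD; rewrite !det_mulmx det_map_mx detM0 mul0r.
move/eqP; rewrite mulf_eq0 det_diag prodf_seq_eq0 => /orP[/hasP[a _] | /eqP detMt].
  by rewrite mxE expf_eq0 polyX_eq0 andbF.
by rewrite Mt0 detMt horner0.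
Qed.

(** The blocks have independent row spaces, since distinct blocks live on
    disjoint sets of columns. *)
Lemma rank_block_diagonal (I : finType) (U : eqType) (lab : I -> U) m n
    (rl : 'I_m -> U) (cl : 'I_n -> U) (M : 'M[K]_(m, n)) :
    injective lab -> (forall a b, M a b != 0 -> rl a = cl b) ->
  (\sum_u \rank (\matrix_(a, b) (M a b *+ (rl a == lab u))) <= \rank M)%N.
Proof.
move=> lab_inj diagM; pose Mu u := \matrix_(a, b) (M a b *+ (rl a == lab u)).
pose Q u : 'M[K]_n := diag_mx (\row_b (cl b == lab u)%:R).
have MuQ u v : Mu u *m Q v = if u == v then Mu u else 0.
  apply/matrixP=> a b; rewrite mul_mx_diag !mxE.
  have [Mab0 | /diagM eq_ab] := eqVneq (M a b) 0.
    by rewrite Mab0 mul0rn mul0r; case: ifP; rewrite !mxE ?Mab0 ?mul0rn.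
  rewrite mulr_natr -mulrnA mulnb -eq_ab.
  have [<-|neq_uv] := eqVneq u v; rewrite !mxE ?andbb //.
  by case: eqVneq => [->|//]; rewrite (inj_eq lab_inj) (negbTE neq_uv).
have dir : mxdirect (\sum_u <<Mu u>>).
  apply/mxdirect_sumsP => u _; apply/eqP; rewrite -submx0.
  set C := (_ :&: _)%MS.
  have CQ : C *m Q u = C.
    have /submxP[y ->] : (C <= Mu u)%MS by rewrite (submx_trans (capmxSl _ _)) ?genmxE.
    by rewrite -mulmxA MuQ eqxx.
  rewrite -CQ; apply: submx_trans (submxMr (Q u) (capmxSr _ _)) _.
  rewrite sumsmxMr; apply/sumsmx_subP => v neq_vu.
  by rewrite (eqmxMr _ (genmxE _)) MuQ (negbTE neq_vu) sub0mx.
have -> : (\sum_u \rank (Mu u) = \rank (\sum_u <<Mu u>>)%MS)%N.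
  by rewrite (mxdirectP dir) /=; apply: eq_bigr => u _; rewrite genmxE.
apply: mxrankS; apply/sumsmx_subP => u _; rewrite genmxE.
apply/submxP; exists (diag_mx (\row_a (rl a == lab u)%:R)).
by apply/matrixP=> a b; rewrite mul_diag_mx !mxE mulr_natl.
Qed.

(** Filtering by [deg] kills the part of [M] strictly above the diagonal
    blocks and can only lower the rank; the finite type [I] names the blocks
    that are counted. *)
Lemma rank_block_triangular (I : finType) (U : eqType) (lab : I -> U)
    (deg : U -> nat) m n (rl : 'I_m -> U) (cl : 'I_n -> U) (M : 'M[K]_(m, n)) :
    injective lab ->
    (forall a b, M a b != 0 -> rl a = cl b \/ (deg (rl a) < deg (cl b))%N) ->
  (\sum_u \rank (\matrix_(a, b) (M a b *+ ((rl a == lab u) && (cl b == lab u))))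
     <= \rank M)%N.
Proof.
move=> lab_inj triM.
have le_deg a b : M a b != 0 -> (deg (rl a) <= deg (cl b))%N.
  by case/triM=> [-> // | /ltnW].
apply: leq_trans (rank_initial_part le_deg).
have diag0 a b : (\matrix_(a, b) (M a b *+ (deg (rl a) == deg (cl b)))) a b != 0 ->
    rl a = cl b.
  rewrite mxE; case: (deg (rl a) =P deg (cl b)) => [eqd | _] /=.
    by case/triM=> //; rewrite eqd ltnn.
  by rewrite mulr0n eqxx.
apply: leq_trans (rank_block_diagonal lab_inj diag0); apply: leq_sum => u _.
apply: eq_leq; congr (\rank _); apply/matrixP=> a b; rewrite !mxE.
have [-> | /triM] := eqVneq (M a b) 0; first by rewrite !mul0rn.
case=> [-> | lt_deg]; first by rewrite eqxx mulr1n andbb.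
rewrite (ltn_eqF lt_deg) mulr0n mul0rn; case: eqP => //= eqa; case: eqP => //= eqb.
by rewrite eqa eqb ltnn in lt_deg.
Qed.

End BlockTriangularRank.

(** * Homogeneous polynomials and matrices *)
Section WeightedHomogeneity.
Variables (K : fieldType) (n : nat) (G : zmodType) (wt : 'I_n -> G).
Local Notation A := {mpoly K[n]}.
Implicit Types (g h : G) (p q : A) (m : 'X_{1..n}).

Lemma wdeg0 : wdeg wt 0%MM = 0.
Proof. by rewrite /wdeg big1 // => i _; rewrite mnm0E. Qed.

Lemma wdegD m1 m2 : wdeg wt (m1 + m2)%MM = wdeg wt m1 + wdeg wt m2.
Proof.
by rewrite /wdeg -big_split; apply: eq_bigr => i _; rewrite mnmDE mulrnDr.
Qed.

Lemma whomogP g p : reflect (forall m, p@_m != 0 -> wdeg wt m = g) (whomog wt g p).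
Proof.
apply: (iffP allP) => hp m; last by rewrite mcoeff_msupp /= => /hp ->.
by rewrite -mcoeff_msupp => /hp /eqP.
Qed.

Lemma whomog0 g : whomog wt g (0 : A).
Proof. by apply/whomogP => m; rewrite mcoeff0 eqxx. Qed.

Lemma whomogD g p q : whomog wt g p -> whomog wt g q -> whomog wt g (p + q).
Proof.
move=> /whomogP hp /whomogP hq; apply/whomogP => m; rewrite mcoeffD.
by have [-> | /hp //] := eqVneq p@_m 0; rewrite add0r => /hq.
Qed.

Lemma whomogN g p : whomog wt g (- p) = whomog wt g p.
Proof.
by apply/whomogP/whomogP => hp m; have := hp m; rewrite mcoeffN oppr_eq0.
Qed.

Lemma whomogM g h p q :
  whomog wt g p -> whomog wt h q -> whomog wt (g + h) (p * q).
Proof.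
move=> /whomogP hp /whomogP hq; apply/whomogP => m.
have [//|/negP nhm] := eqVneq (wdeg wt m) (g + h).
rewrite mcoeffM big1 ?eqxx // => -[k1 k2] /= /eqP def_m.
have [-> | /hp dk1] := eqVneq p@_k1 0; first by rewrite mul0r.
have [-> | /hq dk2] := eqVneq q@_k2 0; first by rewrite mulr0.
by case: nhm; rewrite def_m wdegD dk1 dk2.
Qed.

Lemma whomog_sum (I : Type) (r : seq I) (P : pred I) (F : I -> A) g :
  (forall i, P i -> whomog wt g (F i)) -> whomog wt g (\sum_(i <- r | P i) F i).
Proof. by move=> hF; elim/big_ind: _ => //; [exact: whomog0 | exact: whomogD]. Qed.

Lemma whomogC (c : K) : whomog wt 0 (c%:MP : A).
Proof.
apply/whomogP => m; rewrite mcoeffC.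
by have [->|_] := eqVneq m 0%MM; rewrite ?wdeg0 // mulr0 eqxx.
Qed.

Lemma whomog_mcoeff0 g p : whomog wt g p -> p@_0%MM != 0 -> g = 0.
Proof. by move=> /whomogP hp /hp; rewrite wdeg0. Qed.

Definition hcomp g p : A :=
  \sum_(m <- msupp p | wdeg wt m == g) p@_m *: 'X_[m].

Lemma mcoeff_hcomp g p m : (hcomp g p)@_m = p@_m *+ (wdeg wt m == g).
Proof.
rewrite /hcomp raddf_sum /=.
have [m_p | /memN_msupp_eq0 pm0] := boolP (m \in msupp p); last first.
  rewrite pm0 mul0rn big1_seq // => m' /andP[_ m'p].
  rewrite mcoeffZ mcoeffX; case: eqP => [eqm|]; last by rewrite mulr0.
  by rewrite eqm pm0 mul0r.
rewrite big_mkcond (bigD1_seq m) ?msupp_uniq //= big1 ?addr0.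
  by case: ifP => _; rewrite // mcoeffZ mcoeffX eqxx mulr1.
by move=> m' /negbTE neq; case: ifP => // _; rewrite mcoeffZ mcoeffX neq mulr0.
Qed.

Lemma whomog_hcomp g p : whomog wt g (hcomp g p).
Proof.
apply/whomogP => m; rewrite mcoeff_hcomp.
by have [-> // | _] := eqVneq (wdeg wt m) g; rewrite mulr0n eqxx.
Qed.

Lemma hcomp_id g p : whomog wt g p -> hcomp g p = p.
Proof.
move/whomogP => hp; apply/mpolyP => m; rewrite mcoeff_hcomp.
by have [-> | /hp ->] := eqVneq p@_m 0; rewrite ?mul0rn // eqxx.
Qed.

(** Taking components is linear over homogeneous factors; this is what turns
    solutions of homogeneous linear systems into homogeneous solutions. *)
Lemma hcompM g h p q : whomog wt h q -> hcomp g (p * q) = hcomp (g - h) p * q.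
Proof.
move=> /whomogP hq; apply/mpolyP => m; rewrite mcoeff_hcomp !mcoeffM -sumrMnl.
apply: eq_bigr => -[k1 k2] /= /eqP def_m.
have -> : wdeg wt m = wdeg wt k1 + wdeg wt k2 by rewrite -wdegD -def_m.
rewrite mcoeff_hcomp.
have [-> | /hq ->] := eqVneq q@_k2 0; first by rewrite !mulr0 mul0rn.
by rewrite -mulrnAl eq_sym -subr_eq eq_sym.
Qed.

Lemma hcomp_sum (I : Type) (r : seq I) (P : pred I) (F : I -> A) g :
  hcomp g (\sum_(i <- r | P i) F i) = \sum_(i <- r | P i) hcomp g (F i).
Proof.
apply/mpolyP => m; rewrite mcoeff_hcomp !raddf_sum /= -sumrMnl.
by apply: eq_bigr => i _; rewrite mcoeff_hcomp.
Qed.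

End WeightedHomogeneity.

Section GradedMatrices.
Variables (K : fieldType) (n : nat) (G : zmodType) (wt : 'I_n -> G).
Local Notation A := {mpoly K[n]}.

Definition mx_homog r c (s : 'I_r -> G) (t : 'I_c -> G) (M : 'M[A]_(r, c)) :=
  forall a b, whomog wt (s a - t b) (M a b).

Lemma mx_homogM r c e (s : 'I_r -> G) (t : 'I_c -> G) (u : 'I_e -> G) M M' :
  mx_homog s t M -> mx_homog t u M' -> mx_homog s u (M *m M').
Proof.
move=> hM hM' a b; rewrite mxE; apply: whomog_sum => x _.
by rewrite -(subrKA (t x)); apply: whomogM.
Qed.

Lemma mx_homogD r c (s : 'I_r -> G) (t : 'I_c -> G) M M' :
  mx_homog s t M -> mx_homog s t M' -> mx_homog s t (M + M').
Proof. by move=> hM hM' a b; rewrite mxE; apply: whomogD. Qed.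

Lemma mx_homogN r c (s : 'I_r -> G) (t : 'I_c -> G) M :
  mx_homog s t M -> mx_homog s t (- M).
Proof. by move=> hM a b; rewrite mxE whomogN. Qed.

Lemma mx_homog_diag r (s : 'I_r -> G) (P : pred 'I_r) :
  mx_homog s s (diag_mx (\row_a (P a)%:R)).
Proof.
move=> a b; rewrite !mxE; case: eqP => [->|_]; last exact: whomog0.
by rewrite subrr mulr1n -mpolyC_nat; apply: whomogC.
Qed.

Lemma mx_homog1 r (s : 'I_r -> G) : mx_homog s s 1%:M.
Proof.
move=> a b; rewrite !mxE; case: eqP => [->|_]; last exact: whomog0.
by rewrite subrr mulr1n -mpolyC1; apply: whomogC.
Qed.

(** If each row of [M] is a combination of the rows of [D], the coefficients can
    be chosen homogeneous: replace them by their components of the degrees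
    prescribed by [s] and [t]. *)
Lemma mx_homog_factor r c e (s : 'I_r -> G) (t : 'I_c -> G) (u : 'I_e -> G)
    (M : 'M[A]_(r, e)) (D : 'M[A]_(c, e)) :
    mx_homog s u M -> mx_homog t u D ->
    (forall a, exists v, row a M = v *m D) ->
  exists2 N, mx_homog s t N & M = N *m D.
Proof.
move=> hM hD /fin_all_exists[v defM].
exists (\matrix_(a, b) hcomp wt (s a - t b) (v a 0 b)).
  by move=> a b; rewrite mxE whomog_hcomp.
apply/matrixP=> a b; rewrite -(hcomp_id (hM a b)).
have /rowP/(_ b) := defM a; rewrite !mxE => ->; rewrite hcomp_sum.
apply: eq_bigr => x _; rewrite (hcompM _ _ (hD x b)) !mxE.
by congr (hcomp _ _ _ * _); rewrite opprB addrA subrK.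
Qed.

End GradedMatrices.

(** * Null-homotopies over graded free resolutions *)
(** Chain maps and homotopies are built one degree at a time, each from the
    preceding one; the invariant [I] is what makes the next step possible. *)
Lemma dependent_sequence (X : nat -> Type) (I : forall i, X i -> Prop)
    (R : forall i, X i -> X i.+1 -> Prop) (x0 : X 0%N) :
    I 0%N x0 -> (forall i x, I i x -> exists y, I i.+1 y /\ R i x y) ->
  exists f : forall i, X i,
    [/\ f 0%N = x0, forall i, I i (f i) & forall i, R i (f i) (f i.+1)].
Proof.
move=> I0 next.
pose step i (x : {x | I i x}) :=
  constructive_indefinite_description _ (next i (sval x) (svalP x)).
pose f := fix f i : {x | I i x} :=
  if i is j.+1 then exist _ (sval (step j (f j))) (proj1 (svalP (step j (f j))))
  else exist _ x0 I0.
exists (fun i => sval (f i)); split=> // i; first exact: svalP.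
exact: (proj2 (svalP (step i (f i)))).
Qed.

Section Resolutions.
Variables (K : fieldType) (n : nat) (G : zmodType) (wt : 'I_n -> G).
Local Notation A := {mpoly K[n]}.

(** The augmentation plays the part of the differential out of degree 0, with
    values in P / Q. *)
Definition is_cycle (Q : A -> Prop) (F : graded_free K n G) (i r : nat) :
    'M[A]_(r, gf_rank F i) -> Prop :=
  match i with
  | 0 => fun M => forall a, Q ((M *m gf_aug F) a 0)
  | i'.+1 => fun M => M *m gf_diff F i' = 0
  end.

Definition degree_proj (F : graded_free K n G) (S : pred G) i :
    'M[A]_(gf_rank F i) :=
  diag_mx (\row_a (S (gf_shift a))%:R).

Section OneResolution.
Variables (P Q : A -> Prop) (F : graded_free K n G).
Hypothesis resF : graded_resolution wt P Q F.

Lemma resolution_diff_homog i :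
  mx_homog wt (@gf_shift _ _ _ F i.+1) (@gf_shift _ _ _ F i) (gf_diff F i).
Proof. by case: resF => _ hd _ _ _ a b; apply: hd. Qed.

Lemma resolution_diff_cycle i : is_cycle Q (gf_diff F i).
Proof.
case: resF => _ _ _ ex0 exS; case: i => [a | i] /=.
  have -> : (gf_diff F 0 *m gf_aug F) a 0 = (row a (gf_diff F 0) *m gf_aug F) 0 0.
    by rewrite -row_mul [RHS]mxE.
  by apply/ex0; exists (delta_mx 0 a); rewrite -rowE.
apply/row_matrixP => a; rewrite row_mul row0; apply/exS.
by exists (delta_mx 0 a); rewrite -rowE.
Qed.

(** Exactness, for graded maps out of a free module into cycles. *)
Lemma resolution_lift i r (s : 'I_r -> G) (M : 'M[A]_(r, gf_rank F i)) :
    mx_homog wt s (@gf_shift _ _ _ F i) M -> is_cycle Q M ->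
  exists2 N, mx_homog wt s (@gf_shift _ _ _ F i.+1) N & M = N *m gf_diff F i.
Proof.
move=> hM cM; apply: mx_homog_factor hM (@resolution_diff_homog i) _ => a.
case: resF => _ _ _ ex0 exS; case: i M cM => [|i] M /= cM.
  by apply/ex0; rewrite -row_mul mxE.
by apply/exS; rewrite -row_mul cM row0.
Qed.

Lemma resolution_Q0 : Q 0.
Proof.
case: resF => _ _ _ ex0 _; have -> : 0 = ((0 : 'rV_(gf_rank F 0)) *m gf_aug F) 0 0.
  by rewrite mul0mx mxE.
by apply/ex0; exists 0; rewrite mul0mx.
Qed.

(** The usual comparison argument, restricted to the basis elements whose degree
    lies in [S].  The condition on [S] says that these span a subcomplex.  An
    endomorphism of [F] that sends them, in homological degree 0, to elements
    vanishing in P / Q is then null-homotopic on this subcomplex.  The case where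
    [S] is everything gives the uniqueness of chain maps up to homotopy; the case
    where the identity satisfies this condition gives the vanishing of Tor in the
    degrees of [S]. *)
Lemma nullhomotopy (S : pred G) (phi : forall i, 'M[A]_(gf_rank F i)) :
    (forall i (a : 'I_(gf_rank F i.+1)) (b : 'I_(gf_rank F i)),
        gf_diff F i a b != 0 -> S (gf_shift a) -> S (gf_shift b)) ->
    (forall i, mx_homog wt (@gf_shift _ _ _ F i) (@gf_shift _ _ _ F i) (phi i)) ->
    (forall i, phi i.+1 *m gf_diff F i = gf_diff F i *m phi i) ->
    (forall a : 'I_(gf_rank F 0), S (gf_shift a) -> Q ((phi 0%N *m gf_aug F) a 0)) ->
  exists h : forall i, 'M[A]_(gf_rank F i, gf_rank F i.+1),
    h 0%N *m gf_diff F 0 = degree_proj F S 0%N *m phi 0%N /\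
    forall i, h i.+1 *m gf_diff F i.+1
      = degree_proj F S i.+1 *m (phi i.+1 - gf_diff F i *m h i).
Proof.
move=> downS hphi chain aug0; pose N := degree_proj F S.
have NN i : N i *m N i = N i.
  apply/matrixP=> a b; rewrite mul_diag_mx !mxE.
  by case: (S _); rewrite ?mul1r // mul0r mul0rn.
have NdN i : N i.+1 *m gf_diff F i = N i.+1 *m gf_diff F i *m N i.
  apply/matrixP=> a b; rewrite mul_mx_diag mul_diag_mx !mxE.
  have [-> | /downS dS] := eqVneq (gf_diff F i a b) 0; first by rewrite mulr0 mul0r.
  by case: (S (gf_shift a)) dS => [-> //|_]; rewrite ?mulr1 // !mul0r.
have hN i : mx_homog wt (@gf_shift _ _ _ F i) (@gf_shift _ _ _ F i) (N i).
  exact: mx_homog_diag.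
(* The equation says that phi - d h, on the subcomplex, is a cycle in homological
   degree i.+1, so that it can be lifted. *)
pose I i (h : 'M[A]_(gf_rank F i, gf_rank F i.+1)) :=
  mx_homog wt (@gf_shift _ _ _ F i) (@gf_shift _ _ _ F i.+1) h /\
  N i.+1 *m gf_diff F i *m (phi i - h *m gf_diff F i) = 0.
have [|h0 hh0 def_h0] := resolution_lift (mx_homogM (hN 0) (hphi 0)).
  move=> a; rewrite -mulmxA mul_diag_mx !mxE.
  case Sa: (S _); last by rewrite mul0r; apply: resolution_Q0.
  by rewrite mul1r; have := aug0 a Sa; rewrite mxE.
have I0 : I 0%N h0.
  split=> //; rewrite NdN -(mulmxA _ (N 0%N)) mulmxBr -def_h0 mulmxA NN subrr.
  by rewrite mulmx0.
pose R i (h : 'M[A]_(gf_rank F i, gf_rank F i.+1)) h' :=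
  h' *m gf_diff F i.+1 = N i.+1 *m (phi i.+1 - gf_diff F i *m h).
have [i h [hh Ih] | h [h0E _ stepE]] := dependent_sequence (R := R) I0 _; last first.
  by exists h; rewrite h0E -def_h0; split.
have [||h' hh' def_h'] := @resolution_lift i.+1 _ (@gf_shift _ _ _ F i.+1)
    (N i.+1 *m (phi i.+1 - gf_diff F i *m h)).
- apply: mx_homogM (hN _) _; apply: mx_homogD (hphi _) _; apply: mx_homogN.
  exact: mx_homogM (@resolution_diff_homog _) hh.
- by rewrite /= -mulmxA mulmxBl chain -mulmxA -mulmxBr mulmxA.
exists h'; split; last by rewrite /R.
have NphiB : N i.+1 *m (phi i.+1 - N i.+1 *m (phi i.+1 - gf_diff F i *m h))
    = N i.+1 *m (gf_diff F i *m h).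
  by rewrite mulmxBr (mulmxA (N _) (N _)) NN -mulmxBr opprB addrC subrK.
split=> //; rewrite -def_h' NdN -mulmxA NphiB mulmxA -NdN mulmxA.
by rewrite -(mulmxA _ (gf_diff F i.+1)) (resolution_diff_cycle i.+1) mulmx0 mul0mx.
Qed.

End OneResolution.
End Resolutions.

(** * Tor dimensions as ranks, and their independence of the resolution *)
Section TorDim.
Variables (K : fieldType) (n : nat) (G : zmodType) (wt : 'I_n -> G).
Local Notation A := {mpoly K[n]}.
Local Notation const := (map_mx (mcoeff 0%MM)).

(** A homogeneous entry has a nonzero constant term only in degree 0, so modulo
    the variables a graded map commutes with the projections on the degree [g]
    components. *)
Lemma const_homog_comp r c (s : 'I_r -> G) (t : 'I_c -> G) (M : 'M[A]_(r, c)) g :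
    mx_homog wt s t M ->
  diag_mx (\row_a (s a == g)%:R) *m const M
    = const M *m diag_mx (\row_b (t b == g)%:R) :> 'M[K]_(r, c).
Proof.
move=> hM; apply/matrixP=> a b; rewrite mul_diag_mx mul_mx_diag !mxE.
have [-> | /(whomog_mcoeff0 (hM a b))/eqP] := eqVneq (M a b)@_0%MM 0.
  by rewrite mulr0 mul0r.
by rewrite subr_eq0 => /eqP ->; rewrite mulrC.
Qed.

Lemma res_comp_idem (F : graded_free K n G) i g :
  res_comp F i g *m res_comp F i g = res_comp F i g.
Proof.
apply/matrixP=> a b; rewrite mul_diag_mx !mxE.
by case: (gf_shift a == g); rewrite ?mul1r // mul0r mul0rn.
Qed.

Lemma sub_res_comp (F : graded_free K n G) i g m (M : 'M_(m, _)) :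
  (M <= res_comp F i g)%MS -> M *m res_comp F i g = M.
Proof. by case/submxP=> D ->; rewrite -mulmxA res_comp_idem. Qed.

Section OneResolution.
Variables (P Q : A -> Prop) (F : graded_free K n G).
Hypothesis resF : graded_resolution wt P Q F.

Lemma res_diff_complex i : res_diff F i.+1 *m res_diff F i = 0.
Proof. by rewrite -map_mxM (resolution_diff_cycle resF i.+1) map_mx0. Qed.

Lemma res_boundary_cycle i : (res_diff F i <= res_cycles F i)%MS.
Proof.
by case: i => [|i]; rewrite /= ?submx1 //; apply/sub_kermxP/res_diff_complex.
Qed.

Definition boundary_rank (F : graded_free K n G) i g :=
  \rank (res_diff F i *m res_comp F i g).

Definition coboundary_rank (F : graded_free K n G) i g :=
  if i is i'.+1 then boundary_rank F i' g else 0%N.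

Lemma rank_res_boundary i g :
  \rank (res_diff F i :&: res_comp F i g)%MS = boundary_rank F i g.
Proof.
have comm := const_homog_comp g (@resolution_diff_homog _ _ _ _ _ _ _ resF i).
apply/eqP; rewrite eqn_leq; apply/andP; split; apply: mxrankS.
  rewrite -(sub_res_comp (capmxSr (res_diff F i) _)).
  exact: submxMr (capmxSl _ _).
by rewrite sub_capmx submxMl andbT -comm submxMl.
Qed.

Lemma rank_res_cycles i g :
  (\rank (res_cycles F i :&: res_comp F i g)%MS + coboundary_rank F i g
   = \rank (res_comp F i g))%N.
Proof.
case: i => [|i] /=; first by rewrite cap1mx addn0.
rewrite capmxC addnC -(mxrank_mul_ker (res_comp F i.+1 g) (res_diff F i)).
congr (_ + _)%N; rewrite /boundary_rank.
by rewrite -(const_homog_comp g (@resolution_diff_homog _ _ _ _ _ _ _ resF i)).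
Qed.

Lemma leq_boundary_cycles i g :
  (\rank (res_diff F i :&: res_comp F i g)%MS
    <= \rank (res_cycles F i :&: res_comp F i g)%MS)%N.
Proof. by apply: mxrankS; apply: capmxS => //; apply: res_boundary_cycle. Qed.

(** Rank-nullity.  As the differentials enter with a negative sign, bounding Tor
    from above amounts to bounding their ranks from below. *)
Lemma tor_dimE i g :
  (tor_dim F i g + (boundary_rank F i g + coboundary_rank F i g)
    = \rank (res_comp F i g))%N.
Proof.
rewrite -rank_res_boundary -rank_res_cycles addnA /tor_dim.
by rewrite subnK ?leq_boundary_cycles.
Qed.

End OneResolution.

(** The hypotheses say that [M] induces an injection on homology in
    degree [g]. *)
Lemma tor_dim_map_leq (F F' : graded_free K n G) i g
    (M : 'M[K]_(gf_rank F i, gf_rank F' i)) :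
    (res_diff F' i <= res_cycles F' i)%MS ->
    (res_cycles F i *m M <= res_cycles F' i)%MS ->
    res_comp F i g *m M = M *m res_comp F' i g ->
    (forall z : 'rV_(gf_rank F i),
        (z <= res_cycles F i)%MS -> (z <= res_comp F i g)%MS ->
        (z *m M <= res_diff F' i)%MS -> (z <= res_diff F i)%MS) ->
  (tor_dim F i g <= tor_dim F' i g)%N.
Proof.
move=> BZ' ZZ' comm inj; rewrite /tor_dim.
set Z := (res_cycles F i :&: _)%MS; set B := (res_diff F i :&: _)%MS.
set Z' := (res_cycles F' i :&: _)%MS; set B' := (res_diff F' i :&: _)%MS.
have ZM : (Z *m M <= Z')%MS.
  rewrite sub_capmx (submx_trans (submxMr _ (capmxSl _ _))) //=.
  by rewrite -(sub_res_comp (capmxSr _ _ : Z <= _)%MS) -mulmxA comm mulmxA submxMl.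
have kerB : (Z :&: kermx (M *m cokermx B') <= B)%MS.
  apply/rV_subP => z; rewrite !sub_capmx => /andP[/andP[zZ zE] /sub_kermxP].
  rewrite mulmxA => /eqP; rewrite -submxE => zB'.
  by rewrite zE andbT inj // (submx_trans zB') ?capmxSl.
have kerB' : (B' <= Z' :&: kermx (cokermx B'))%MS.
  by rewrite sub_capmx capmxS //=; apply/sub_kermxP; rewrite mulmx_coker.
have le_image : (\rank (Z *m (M *m cokermx B')) <= \rank (Z' *m cokermx B'))%N.
  by rewrite mulmxA; apply: mxrankS (submxMr _ ZM).
have dimZ' : (\rank (Z' *m cokermx B') <= \rank Z' - \rank B')%N.
  rewrite -(mxrank_mul_ker Z' (cokermx B')) -[leqLHS](addnK (\rank B')).
  by rewrite leq_sub2r // leq_add2l mxrankS.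
rewrite leq_subLR -(mxrank_mul_ker Z (M *m cokermx B')) addnC.
exact: leq_add (mxrankS kerB) (leq_trans le_image dimZ').
Qed.

Section Nullhomotopic.
Variables (P Q : A -> Prop) (F : graded_free K n G).
Hypothesis resF : graded_resolution wt P Q F.

Lemma nullhomotopic_boundary (S : pred G)
    (phi : forall i, 'M[A]_(gf_rank F i)) i g (z : 'rV_(gf_rank F i)) :
    (forall i (a : 'I_(gf_rank F i.+1)) (b : 'I_(gf_rank F i)),
        gf_diff F i a b != 0 -> S (gf_shift a) -> S (gf_shift b)) ->
    (forall i, mx_homog wt (@gf_shift _ _ _ F i) (@gf_shift _ _ _ F i) (phi i)) ->
    (forall i, phi i.+1 *m gf_diff F i = gf_diff F i *m phi i) ->
    (forall a : 'I_(gf_rank F 0), S (gf_shift a) -> Q ((phi 0%N *m gf_aug F) a 0)) ->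
    S g -> (z <= res_cycles F i)%MS -> (z <= res_comp F i g)%MS ->
  (z *m const (phi i) <= res_diff F i)%MS.
Proof.
move=> downS hphi chain aug0 Sg zZ zE.
have [h [h0 hS]] := nullhomotopy resF downS hphi chain aug0.
have zN : z *m const (degree_proj F S i) = z.
  rewrite -(sub_res_comp zE) -mulmxA; congr (_ *m _).
  apply/matrixP=> a b; rewrite mul_diag_mx !mxE.
  have [-> | _] := eqVneq (gf_shift a) g; last by rewrite mul0r mul0rn.
  by rewrite Sg mul1r rmorphMn /= mcoeff1 eqxx.
case: i z zZ zE zN => [|i] z zZ _ zN.
  by rewrite -zN -mulmxA -map_mxM -h0 map_mxM mulmxA submxMl.
rewrite -zN -mulmxA -map_mxM.
rewrite -[phi i.+1](subrK (gf_diff F i *m h i)) mulmxDr -hS map_mxD !map_mxM.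
rewrite mulmxDr mulmxA addmx_sub ?submxMl // mulmxA zN mulmxA.
by move/sub_kermxP: zZ; rewrite /res_diff => ->; rewrite mul0mx sub0mx.
Qed.

Lemma tor_dim_eq0_of_degrees (S : pred G) i g :
    (forall i (a : 'I_(gf_rank F i.+1)) (b : 'I_(gf_rank F i)),
        gf_diff F i a b != 0 -> S (gf_shift a) -> S (gf_shift b)) ->
    (forall a : 'I_(gf_rank F 0), S (gf_shift a) -> Q (gf_aug F a 0)) ->
    S g -> tor_dim F i g = 0%N.
Proof.
move=> downS aug0 Sg; apply/eqP; rewrite /tor_dim subn_eq0; apply: mxrankS.
rewrite sub_capmx capmxSr andbT; apply/rV_subP => z; rewrite sub_capmx => /andP[zZ zE].
have := nullhomotopic_boundary (phi := fun i => 1%:M) downS _ _ _ Sg zZ zE.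
rewrite map_mx1 mulmx1; apply=> [i' | i' | a Sa].
- exact: mx_homog1.
- by rewrite mul1mx mulmx1.
- by rewrite mul1mx; apply: aug0.
Qed.

End Nullhomotopic.

Section Comparison.
Variables (P : A -> Prop) (F F' : graded_free K n G).
Hypotheses (resF : graded_resolution wt P (fun p => p = 0) F)
           (resF' : graded_resolution wt P (fun p => p = 0) F').

(** Free modules lift through exact sequences, so the identity of P extends to
    a graded chain map. *)
Lemma comparison_map : exists alpha : forall i, 'M[A]_(gf_rank F i, gf_rank F' i),
  [/\ forall i, mx_homog wt (@gf_shift _ _ _ F i) (@gf_shift _ _ _ F' i) (alpha i),
      alpha 0%N *m gf_aug F' = gf_aug F
    & forall i, alpha i.+1 *m gf_diff F' i = gf_diff F i *m alpha i].
Proof.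
have haug (F1 : graded_free K n G) : graded_resolution wt P (fun p => p = 0) F1 ->
    mx_homog wt (@gf_shift _ _ _ F1 0) (fun=> 0) (gf_aug F1).
  by case=> ha _ _ _ _ a b; rewrite subr0 ord1; apply: ha.
have augP a : P (gf_aug F a 0).
  case: resF => _ _ defP _ _; apply/defP; exists (delta_mx 0 a).
  by rewrite -rowE mxE subrr.
have [|alpha0 halpha0 aug_alpha0] := mx_homog_factor (haug F resF) (haug F' resF').
  move=> a; case: resF' => _ _ defP _ _; have /defP[v eqv] := augP a.
  exists v; apply/rowP => b; rewrite ord1 mxE; apply/eqP.
  by rewrite -subr_eq0 eqv.
pose I i (M : 'M[A]_(gf_rank F i, gf_rank F' i)) :=
  mx_homog wt (@gf_shift _ _ _ F i) (@gf_shift _ _ _ F' i) M /\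
  is_cycle (fun p => p = 0) (gf_diff F i *m M).
pose R i (M : 'M[A]_(gf_rank F i, gf_rank F' i)) M' :=
  M' *m gf_diff F' i = gf_diff F i *m M.
have I0 : I 0%N alpha0.
  split=> // a; rewrite -mulmxA -aug_alpha0.
  exact: (resolution_diff_cycle resF 0%N).
have [i M [hM cM] | alpha [alpha0E Ialpha Ralpha]] :=
  dependent_sequence (R := R) I0 _; last first.
  by exists alpha; split=> // [i|]; [case: (Ialpha i) | rewrite alpha0E].
have [M' hM' defM'] := resolution_lift resF'
  (mx_homogM (@resolution_diff_homog _ _ _ _ _ _ _ resF i) hM) cM.
exists M'; split=> //; split=> //=.
by rewrite -mulmxA -defM' mulmxA (resolution_diff_cycle resF i.+1) mul0mx.
Qed.

End Comparison.

(** The two comparison maps compose to a chain map homotopic to the identity of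
    [F], so the first one is injective on Tor. *)
Lemma tor_dim_resolution_leq (P : A -> Prop) (F F' : graded_free K n G) i g :
    graded_resolution wt P (fun p => p = 0) F ->
    graded_resolution wt P (fun p => p = 0) F' ->
  (tor_dim F i g <= tor_dim F' i g)%N.
Proof.
move=> resF resF'.
have [alpha [halpha aug_alpha chain_alpha]] := comparison_map resF resF'.
have [beta [hbeta aug_beta chain_beta]] := comparison_map resF' resF.
apply: (@tor_dim_map_leq _ _ _ _ (const (alpha i))).
- exact: res_boundary_cycle resF' _.
- case: i => [|i] /=; first exact: submx1.
  apply/sub_kermxP; rewrite -mulmxA -map_mxM chain_alpha map_mxM mulmxA.
  by rewrite mulmx_ker mul0mx.
- exact: const_homog_comp.
move=> z zZ zE zB; pose phi i := alpha i *m beta i - 1%:M.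
have := @nullhomotopic_boundary _ _ _ resF predT phi i g z.
have -> : z *m const (phi i) = z *m const (alpha i) *m const (beta i) - z.
  by rewrite map_mxB map_mx1 map_mxM mulmxBr mulmx1 mulmxA.
move=> null; have {null} zphi := null _ _ _ _ isT zZ zE.
rewrite -[z](subKr (z *m const (alpha i) *m const (beta i))) addmx_sub //.
  have /submxP[D ->] := zB; rewrite -mulmxA -map_mxM -chain_beta map_mxM mulmxA.
  exact: submxMl.
rewrite eqmx_opp; apply: zphi => [//| i' | i' | a _].
- apply: mx_homogD; first exact: mx_homogM (halpha _) (hbeta _).
  by apply: mx_homogN; apply: mx_homog1.
- rewrite mulmxBl mulmxBr -mulmxA chain_beta mul1mx mulmx1 mulmxA chain_alpha.
  by rewrite mulmxA.
- by rewrite mulmxBl -mulmxA aug_beta aug_alpha mul1mx subrr mxE.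
Qed.

End TorDim.

(** * Separating the two groups of variables *)
Section SplitVariables.
Variables (K : fieldType) (N k : nat).
Local Notation R := {mpoly K[N]}.
Local Notation A := {mpoly K[N + k.+1]}.
Local Notation B := {mpoly {mpoly K[N]}[k.+1]}.

(** Monomials of the polynomial ring in x and w, as pairs of a monomial [v] in x
    and a monomial [u] in w. *)
Definition mcat (v : 'X_{1..N}) (u : 'X_{1..k.+1}) : 'X_{1..N + k.+1} :=
  [multinom match split i with inl a => v a | inr b => u b end | i < N + k.+1].

Lemma mcat_lshift v u i : mcat v u (lshift _ i) = v i.
Proof. by rewrite mnmE (unsplitK (inl i)). Qed.

Lemma mcat_rshift v u j : mcat v u (rshift _ j) = u j.
Proof. by rewrite mnmE (unsplitK (inr j)). Qed.

Lemma mcat_ex m : exists v u, m = mcat v u.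
Proof.
exists [multinom m (lshift _ i) | i < N], [multinom m (rshift _ j) | j < k.+1].
apply/mnmP => i; rewrite -(splitK i); case: (split i) => x /=.
  by rewrite mcat_lshift mnmE.
by rewrite mcat_rshift mnmE.
Qed.

Lemma mcat_inj v u v' u' : mcat v u = mcat v' u' -> v = v' /\ u = u'.
Proof.
move/mnmP=> eqm; split; apply/mnmP => i.
  by rewrite -(mcat_lshift v u) eqm mcat_lshift.
by rewrite -(mcat_rshift v u) eqm mcat_rshift.
Qed.

Lemma mcat_le v u v' u' : (mcat v u <= mcat v' u')%MM -> (u <= u')%MM.
Proof.
move/mnm_lepP => le_m; apply/mnm_lepP => j.
by have := le_m (rshift _ j); rewrite !mcat_rshift.
Qed.

Lemma wdeg_std n (m : 'X_{1..n}) : wdeg (@std_wt n) m = (mdeg m)%:Z.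
Proof.
rewrite /wdeg mdegE -natz natr_sum; apply: eq_bigr => i _; exact: erefl.
Qed.

Lemma wdeg_mcat v u : wdeg (@rees_wt N k) (mcat v u) = ((mdeg v)%:Z, (mdeg u)%:Z).
Proof.
apply: injective_projections; rewrite /wdeg raddf_sum big_split_ord /= mdegE.
  rewrite -[RHS]natz natr_sum [X in _ + X]big1 ?addr0 => [|j _].
    apply: eq_bigr => i _.
    by rewrite mcat_lshift pairMnE /rees_wt (unsplitK (inl i)) natz.
  by rewrite pairMnE /rees_wt (unsplitK (inr j)) /= mul0rn.
rewrite -[RHS]natz natr_sum [X in X + _]big1 ?add0r => [|i _].
  apply: eq_bigr => j _.
  by rewrite mcat_rshift pairMnE /rees_wt (unsplitK (inr j)) natz.
by rewrite pairMnE /rees_wt (unsplitK (inl i)) /= mul0rn.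
Qed.

(** The isomorphism K[x, w] -> K[x][w].  It is locked because unfolding it makes
    conversion compute with sums over supports. *)
Fact split_poly_key : unit. Proof. by []. Qed.

Definition split_poly : A -> B := locked_with split_poly_key
  (mmap (@mpolyC k.+1 R \o @mpolyC N K)
        (fun v => match split v with inl i => ('X_i)%:MP | inr j => 'X_j end)).

Lemma split_polyE : split_poly = mmap (@mpolyC k.+1 R \o @mpolyC N K)
  (fun v => match split v with inl i => ('X_i)%:MP | inr j => 'X_j end).
Proof. exact: unlock. Qed.

Fact split_poly_is_zmod_morphism : zmod_morphism split_poly.
Proof. by rewrite split_polyE; apply: mmapB. Qed.

Fact split_poly_is_monoid_morphism : monoid_morphism split_poly.
Proof. by rewrite split_polyE; split; [apply: rmorph1 | apply: rmorphM]. Qed.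

HB.instance Definition _ :=
  GRing.isZmodMorphism.Build A B split_poly split_poly_is_zmod_morphism.
HB.instance Definition _ :=
  GRing.isMonoidMorphism.Build A B split_poly split_poly_is_monoid_morphism.

Lemma split_polyZX c v u :
  split_poly (c *: 'X_[mcat v u]) = (c *: 'X_[v]) *: 'X_[u].
Proof.
rewrite split_polyE mmapZ mmapX /mmap1 big_split_ord /=.
rewrite (eq_bigr (fun i => ('X_i ^+ v i)%:MP)) => [|i _]; last first.
  by rewrite mcat_lshift (unsplitK (inl i)) rmorphXn.
rewrite -rmorph_prod /= -mpolyXE_id [X in _ * (_ * X)](_ : _ = 'X_[u]).
  by rewrite mulrA -mpolyCM !mul_mpolyC.
rewrite [RHS]mpolyXE_id; apply: eq_bigr => j _.
by rewrite mcat_rshift (unsplitK (inr j)).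
Qed.

Lemma mcoeff_split_poly p v u : (split_poly p)@_u@_v = p@_(mcat v u).
Proof.
rewrite [p in LHS]mpolyE [p in RHS]mpolyE.
rewrite (raddf_sum split_poly) !raddf_sum /=.
apply: eq_bigr => m _; have [v' [u' ->]] := mcat_ex m.
rewrite split_polyZX mcoeffZ mcoeffX mcoeffZ mcoeffX.
have [<- | neq_u] := eqVneq u' u.
  rewrite mulr1 mcoeffZ mcoeffX; have [<- | neq_v] := eqVneq v' v.
    by rewrite eqxx.
  by case: eqP => // /mcat_inj[eqv _]; rewrite eqv eqxx in neq_v.
rewrite mulr0 mcoeff0; case: eqP => [/mcat_inj[_ equ]|]; last by rewrite mulr0.
by rewrite equ eqxx in neq_u.
Qed.

Lemma split_poly_inj : injective split_poly.
Proof.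
move=> p q eq_pq; apply/mpolyP => m; have [v [u ->]] := mcat_ex m.
by rewrite -!mcoeff_split_poly eq_pq.
Qed.

Lemma split_poly_surj q : exists p, split_poly p = q.
Proof.
exists (\sum_(u <- msupp q) \sum_(v <- msupp q@_u) q@_u@_v *: 'X_[mcat v u]).
rewrite [RHS]mpolyE raddf_sum; apply: eq_bigr => u _.
rewrite raddf_sum [q@_u in RHS]mpolyE scaler_suml; apply: eq_bigr => v _.
exact: split_polyZX.
Qed.

Definition wmon (u : 'X_{1..k.+1}) : A := 'X_[mcat 0 u].

Lemma split_poly_wmon u : split_poly (wmon u) = 'X_[u].
Proof.
rewrite /wmon -['X_[mcat 0 u]]scale1r split_polyZX mpolyX0 scale1r.
by rewrite -mul_mpolyC mpolyC1 mul1r.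
Qed.

Lemma whomog_wmon u : whomog (@rees_wt N k) (0, (mdeg u)%:Z) (wmon u).
Proof.
apply/whomogP => m; rewrite mcoeffX.
have [<- _ | _] := eqVneq (mcat 0 u) m; last by rewrite eqxx.
by rewrite wdeg_mcat mdeg0.
Qed.

Lemma split_poly_homog (g : int * int) p u : whomog (@rees_wt N k) g p ->
  whomog (@std_wt N) g.1 (split_poly p)@_u.
Proof.
move=> /whomogP hp; apply/whomogP => v; rewrite mcoeff_split_poly => /hp <-.
by rewrite wdeg_std wdeg_mcat.
Qed.

Lemma split_poly_deg (g : int * int) p u : whomog (@rees_wt N k) g p ->
  (split_poly p)@_u != 0 -> (mdeg u)%:Z = g.2.
Proof.
move=> /whomogP hp; apply: contraNeq => neq; apply/eqP/mpolyP => v.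
rewrite mcoeff0 mcoeff_split_poly; apply/eqP; apply: contraNT neq => /hp.
by rewrite wdeg_mcat => <-.
Qed.

Variable f : 'I_k.+1 -> R.

(** The presentation of the Rees algebra, read on K[x][w]. *)
Definition rees_eval : B -> {poly R} := mmap polyC (fun j => f j *: 'X).

HB.instance Definition _ := GRing.RMorphism.copy rees_eval
  (mmap polyC (fun j => f j *: 'X)).

Definition gen_mon (u : 'X_{1..k.+1}) : R := \prod_j f j ^+ u j.

Lemma rees_evalZX c u : rees_eval (c *: 'X_[u]) = (c * gen_mon u) *: 'X^(mdeg u).
Proof.
rewrite /rees_eval mmapZ mmapX mul_polyC -scalerA; congr (_ *: _).
rewrite /mmap1 (eq_bigr (fun j => f j ^+ u j *: 'X^(u j))); last first.
  by move=> j _; rewrite exprZn.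
by rewrite scaler_prod; congr (_ *: _); rewrite prodrXr mdegE.
Qed.

Lemma rees_evalE q :
  rees_eval q = \sum_(u <- msupp q) (q@_u * gen_mon u) *: 'X^(mdeg u).
Proof.
rewrite [in LHS](mpolyE q) raddf_sum; apply: eq_bigr => u _; exact: rees_evalZX.
Qed.

Lemma coef_rees_eval q d :
  (rees_eval q)`_d = \sum_(u <- msupp q | mdeg u == d) q@_u * gen_mon u.
Proof.
rewrite rees_evalE coef_sum [RHS]big_mkcond; apply: eq_bigr => u _.
by rewrite coefZ coefXn eq_sym; case: eqP; rewrite (mulr1, mulr0).
Qed.

Lemma rees_mapE p : rees_map f p = rees_eval (split_poly p).
Proof.
rewrite [p in RHS]mpolyE (raddf_sum split_poly) (raddf_sum rees_eval).
apply: eq_bigr => m _; have [v [u ->]] := mcat_ex m.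
rewrite /= split_polyZX rees_evalZX -scalerAl -mul_mpolyC -scalerA -mul_polyC.
congr (_ * _); rewrite /mmap1 big_split_ord /=.
rewrite (eq_bigr (fun i => ('X_i ^+ v i)%:P)) => [|i _]; last first.
  by rewrite mcat_lshift (unsplitK (inl i)) rmorphXn.
rewrite -rmorph_prod /= -mpolyXE_id mul_polyC -scalerA; congr (_ *: _).
rewrite (eq_bigr (fun j => f j ^+ u j *: 'X^(u j))) => [|j _]; last first.
  by rewrite mcat_rshift (unsplitK (inr j)) exprZn.
by rewrite scaler_prod prodrXr mdegE.
Qed.

End SplitVariables.

(** * Powers of an ideal and components of its Rees algebra *)
Section IdealPowers.
Variable (C : comNzRingType).

Lemma ideal_exp_absorb (P : C -> Prop) d c p :
  (forall c p, P p -> P (c * p)) -> ideal_exp P d p -> ideal_exp P d (c * p).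
Proof.
case: d => [//|d] absP [n [a [b [Pa Pb ->]]]].
exists n, (fun i => c * a i), b; split=> // [i|]; first exact: absP.
by rewrite mulr_sumr; apply: eq_bigr => i _; rewrite mulrA.
Qed.

Lemma ideal_exp0 (P : C -> Prop) d : ideal_exp P d 0.
Proof.
case: d => [//|d]; exists 0%N, (fun=> 0), (fun=> 0).
by split=> [[]//|[]//|]; rewrite big_ord0.
Qed.

Lemma ideal_expD (P : C -> Prop) d p q :
  ideal_exp P d p -> ideal_exp P d q -> ideal_exp P d (p + q).
Proof.
case: d => [//|d] [n1 [a1 [b1 [Pa1 Pb1 ->]]]] [n2 [a2 [b2 [Pa2 Pb2 ->]]]].
exists (n1 + n2)%N, (fun i => match split i with inl x => a1 x | inr y => a2 y end),
  (fun i => match split i with inl x => b1 x | inr y => b2 y end).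
split=> [i|i|]; try by case: split.
by rewrite big_split_ord /=; congr (_ + _); apply: eq_bigr => i _;
  rewrite (unsplitK (inl i), unsplitK (inr i)).
Qed.

Lemma ideal_gen_absorb n (f : 'I_n -> C) c p : ideal_gen f p -> ideal_gen f (c * p).
Proof.
case=> g ->; exists (fun i => c * g i); rewrite mulr_sumr.
by apply: eq_bigr => i _; rewrite mulrA.
Qed.

Lemma ideal_gen_mem n (f : 'I_n -> C) i : ideal_gen f (f i).
Proof.
exists (fun j => (i == j)%:R); rewrite (bigD1 i) //= eqxx mul1r big1 ?addr0 // => j neq.
by rewrite eq_sym (negbTE neq) mul0r.
Qed.

End IdealPowers.

Section Rees.
Variables (K : fieldType) (N k : nat) (f : 'I_k.+1 -> {mpoly K[N]}).
Local Notation R := {mpoly K[N]}.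
Local Notation B := {mpoly {mpoly K[N]}[k.+1]}.
Local Notation Ipow := (ideal_exp (ideal_gen f)).

(** Split off one generator occurring in the monomial. *)
Lemma gen_mon_ideal u : Ipow (mdeg u) (gen_mon f u).
Proof.
move: {2}(mdeg u) (erefl (mdeg u)) => d.
elim: d u => [|d IHd] u deg_u; rewrite deg_u //.
have [j uj] : exists j, u j != 0%N.
  apply/existsP; apply: contraTT (eqxx (mdeg u)) => /existsPn u0.
  by rewrite {2}deg_u mdegE big1 // => j _; apply/eqP; rewrite -[_ == _]negbK.
have def_u : u = (U_(j) + (u - U_(j)))%MM by rewrite addmC submK // lep1mP.
have deg_u' : mdeg (u - U_(j))%MM = d.
  by move: deg_u; rewrite {1}def_u mdegD mdeg1 => -[].
exists 1%N, (fun=> f j), (fun=> gen_mon f (u - U_(j))).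
split=> [_|_|]; first exact: ideal_gen_mem.
  by rewrite -deg_u'; apply: IHd.
rewrite big_ord1 {1}def_u /gen_mon.
rewrite (eq_bigr (fun i => f i ^+ U_(j)%MM i * f i ^+ (u - U_(j))%MM i)); last first.
  by move=> i _; rewrite mnmDE exprD.
rewrite big_split /=; congr (_ * _); rewrite (bigD1 j) //= mnm1E eqxx expr1.
by rewrite big1 ?mulr1 // => i neq; rewrite mnm1E eq_sym (negbTE neq).
Qed.

Lemma coef_rees_eval_ideal q d : Ipow d (rees_eval f q)`_d.
Proof.
rewrite coef_rees_eval; elim/big_ind: _ => [||u /eqP <-]; first exact: ideal_exp0.
  exact: ideal_expD.
by apply: ideal_exp_absorb (gen_mon_ideal u) => c p; apply: ideal_gen_absorb.
Qed.

(** Together with [coef_rees_eval_ideal], this identifies the degree [d]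
    component of the Rees algebra with I^d. *)
Lemma ideal_rees_eval d p : Ipow d p -> exists q, rees_eval f q = p *: 'X^d.
Proof.
elim: d p => [|d IHd] p /=.
  by exists (p%:MP); rewrite /rees_eval mmapC expr0 alg_polyC.
case=> n [a [b [/fin_all_exists[g defa] Pb ->]]].
have /fin_all_exists[q defq] : forall i, exists q, rees_eval f q = b i *: 'X^d.
  by move=> i; apply: IHd.
exists (\sum_i (\sum_j g i j *: 'X_j) * q i); rewrite raddf_sum scaler_suml /=.
apply: eq_bigr => i _; rewrite rmorphM /= defq raddf_sum defa.
have -> : \sum_j rees_eval f (g i j *: 'X_j) = (\sum_j g i j * f j) *: 'X.
  rewrite scaler_suml; apply: eq_bigr => j _.
  by rewrite /rees_eval mmapZ mmapX mmap1U mul_polyC scalerA.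
by rewrite -scalerAr -scalerAl exprS scalerA mulrC.
Qed.

Lemma rees_eval_homog q d : (forall u, q@_u != 0 -> mdeg u = d) ->
  rees_eval f q = (rees_eval f q)`_d *: 'X^d.
Proof.
move=> hq; rewrite coef_rees_eval {1}rees_evalE scaler_suml [RHS]big_mkcond /=.
apply: eq_big_seq => u; rewrite mcoeff_msupp => /hq deg_u.
by rewrite deg_u eqxx.
Qed.

Lemma coef_rees_eval0 q d : (forall u, q@_u != 0 -> mdeg u != d) ->
  (rees_eval f q)`_d = 0.
Proof.
move=> hq; rewrite coef_rees_eval big_seq_cond big1 // => u.
by rewrite mcoeff_msupp => /andP[/hq/negbTE->].
Qed.

Lemma whomog_gen_mon r : (forall a, f a \is r.-homog) ->
  forall u, whomog (@std_wt N) (r * mdeg u)%N%:Z (gen_mon f u).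
Proof.
move=> hf u; rewrite mdegE big_distrr /=.
rewrite /gen_mon; elim/big_rec2: _ => [|j x y _ hy].
  by rewrite -mpolyC1; apply: whomogC.
rewrite PoszD; apply: whomogM hy; elim: (u j) => [|e IHe].
  by rewrite muln0 expr0 -mpolyC1; apply: whomogC.
rewrite mulnS PoszD exprS; apply: whomogM IHe; apply/whomogP => m m_f.
have /dhomogP/(_ m) := hf j; rewrite mcoeff_msupp => /(_ m_f) <-.
exact: wdeg_std.
Qed.

End Rees.

(** * Strands of a resolution of the Rees algebra *)
Lemma map_mx_entry (aT rT : Type) (g : aT -> rT) m n (M : 'M[aT]_(m, n)) a b :
  map_mx g M a b = g (M a b).
Proof. by rewrite (mxE map_mx_key). Qed.

Section Strand.
Variables (K : fieldType) (N k r : nat) (f : 'I_k.+1 -> {mpoly K[N]}).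
Hypothesis hf : forall a, f a \is r.-homog.
Variables (F : graded_free K (N + k.+1) (int * int)%type) (d : nat).
Local Notation R := {mpoly K[N]}.
Local Notation A := {mpoly K[N + k.+1]}.
Local Notation B := {mpoly {mpoly K[N]}[k.+1]}.
Local Notation theta := (@split_poly K N k).
Local Notation ev := (rees_eval f).

(** A bound on the w-degree of the monomials occurring below, which makes their
    type finite. *)
Definition strand_bound i := (d + \sum_(b < gf_rank F i) `|(gf_shift b).2|).+1.

(** The component of w-degree [d] of F_i is a free K[x]-module on the w^u e_b
    with |u| = d - deg_w e_b. *)
Definition strand_set i : {set 'I_(gf_rank F i) * 'X_{1..k.+1 < strand_bound i}} :=
  [set s | (mdeg (bmnm s.2))%:Z == d%:Z - (gf_shift s.1).2].

Definition strand_rank i := #|strand_set i|.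

Definition strand_gen i (a : 'I_(strand_rank i)) : 'I_(gf_rank F i) :=
  (enum_val a).1.

Definition strand_mon i (a : 'I_(strand_rank i)) : 'X_{1..k.+1} := (enum_val a).2.

Lemma mdeg_strand_mon i (a : 'I_(strand_rank i)) :
  (mdeg (strand_mon a))%:Z = d%:Z - (gf_shift (strand_gen a)).2.
Proof. by have := enum_valP a; rewrite inE => /eqP. Qed.

Lemma strand_index_inj i (a a' : 'I_(strand_rank i)) :
  strand_gen a = strand_gen a' -> strand_mon a = strand_mon a' -> a = a'.
Proof.
move=> eq_gen eq_mon; apply: enum_val_inj.
by apply: injective_projections; last apply: val_inj.
Qed.

Lemma strand_mon_bound i (b : 'I_(gf_rank F i)) (u : 'X_{1..k.+1}) :
  (mdeg u)%:Z = d%:Z - (gf_shift b).2 -> (mdeg u < strand_bound i)%N.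
Proof.
move=> deg_u; rewrite ltnS -lez_nat deg_u PoszD lerD2l.
apply: le_trans (ler_norm _) _; rewrite normrN -abszE lez_nat.
by rewrite (bigD1 b) //= leq_addr.
Qed.

Lemma strand_index_ex i (b : 'I_(gf_rank F i)) (u : 'X_{1..k.+1}) :
    (mdeg u)%:Z = d%:Z - (gf_shift b).2 ->
  exists a : 'I_(strand_rank i), strand_gen a = b /\ strand_mon a = u.
Proof.
move=> deg_u; have ltu := strand_mon_bound deg_u.
have su : (b, BMultinom ltu) \in strand_set i by rewrite inE /= deg_u.
exists (enum_rank_in su (b, BMultinom ltu)).
by rewrite /strand_gen /strand_mon enum_rankK_in.
Qed.

(** The component of w-degree [d] of [F], a complex of free K[x]-modules in the
    bases above.  The x-degrees are raised by [r * d] because the component of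
    x-degree [s] and w-degree [d] of the Rees algebra is the component of degree
    [s + r * d] of I^d. *)
Definition strand : graded_free K N int := @GradedFree K N int strand_rank
  (fun i a => (gf_shift (strand_gen a)).1 + (r * d)%N%:Z)
  (fun i => \matrix_(a, b)
     (theta (wmon K N (strand_mon a)
               * gf_diff F i (strand_gen a) (strand_gen b)))@_(strand_mon b))
  (\col_a (ev (theta (wmon K N (strand_mon a) * gf_aug F (strand_gen a) 0)))`_d).

(** The embedding of the strand into [F], as a matrix over K[x][w]. *)
Definition strand_pack i : 'M[B]_(strand_rank i, gf_rank F i) :=
  \matrix_(a, b) ('X_[strand_mon a] *+ (strand_gen a == b)).

(** The K[x]-linear projection of [F] onto its strand. *)
Definition strand_unpack i (V : 'rV[A]_(gf_rank F i)) : 'rV[R]_(strand_rank i) :=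
  \row_a (theta (V 0 (strand_gen a)))@_(strand_mon a).

Lemma strand_part_coef i (b : 'I_(gf_rank F i)) (q : B) u :
  (\sum_(a < strand_rank i)
      q@_(strand_mon a) *: ('X_[strand_mon a] *+ (strand_gen a == b)))@_u
    = q@_u *+ ((mdeg u)%:Z == d%:Z - (gf_shift b).2).
Proof.
rewrite raddf_sum /=; case: eqP => [/strand_index_ex[a [<- <-]] | ndeg].
  rewrite (bigD1 a) //= big1 ?addr0 => [|a' neq_a]; last first.
    rewrite mcoeffZ mcoeffMn mcoeffX.
    case: (_ =P strand_mon a) => [eqm|_]; last by rewrite mul0rn mulr0.
    case: (_ =P strand_gen a) => [eqg|_]; last by rewrite mulr0n mulr0.
    by rewrite (strand_index_inj eqg eqm) eqxx in neq_a.
  by rewrite mcoeffZ mcoeffMn mcoeffX !eqxx mulr1.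
rewrite big1 // => a _; rewrite mcoeffZ mcoeffMn mcoeffX.
case: (_ =P u) => [eqm|_]; last by rewrite mul0rn mulr0.
case: (_ =P b) => [eqg|_]; last by rewrite mulr0n mulr0.
by case: ndeg; rewrite -eqm mdeg_strand_mon eqg.
Qed.

Hypothesis resF :
  graded_resolution (@rees_wt N k) (fun _ => True) (rees_ideal f) F.

Lemma strand_diff_entry_homog i (a : 'I_(strand_rank i.+1)) (b : 'I_(gf_rank F i)) :
  whomog (@rees_wt N k)
    ((gf_shift (strand_gen a)).1 - (gf_shift b).1, d%:Z - (gf_shift b).2)
    (wmon K N (strand_mon a) * gf_diff F i (strand_gen a) b).
Proof.
have := whomogM (whomog_wmon K N (strand_mon a))
  (resolution_diff_homog resF (strand_gen a) b).
congr (whomog _ _ _); apply: injective_projections => /=; first by rewrite add0r.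
by rewrite mdeg_strand_mon addrA subrK.
Qed.

Lemma strand_aug_entry_homog (a : 'I_(strand_rank 0)) :
  whomog (@rees_wt N k) ((gf_shift (strand_gen a)).1, d%:Z)
    (wmon K N (strand_mon a) * gf_aug F (strand_gen a) 0).
Proof.
case: resF => haug _ _ _ _.
have := whomogM (whomog_wmon K N (strand_mon a)) (haug (strand_gen a)).
congr (whomog _ _ _); apply: injective_projections => /=; first by rewrite add0r.
by rewrite mdeg_strand_mon subrK.
Qed.

(** A K[x]-linear form that only sees one w-degree does not distinguish [U] from
    its strand component.  It is applied to the coefficients of the differential
    and to the degree [d] coefficient of the augmentation. *)
Lemma strand_unpack_sum i (L : {additive B -> R}) (p : 'I_(gf_rank F i) -> B)
    (U : 'rV[A]_(gf_rank F i)) :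
    (forall c q, L (c *: q) = c * L q) ->
    (forall b (q : B),
       (forall u, q@_u != 0 -> (mdeg u)%:Z != d%:Z - (gf_shift b).2) ->
       L (q * p b) = 0) ->
  \sum_a strand_unpack U 0 a * L ('X_[strand_mon a] * p (strand_gen a))
    = L (\sum_b theta (U 0 b) * p b).
Proof.
move=> LZ L0; (* The part of the coordinate of U at b that lies in the strand. *)
pose W b : B := \sum_(a < strand_rank i)
  (theta (U 0 b))@_(strand_mon a) *: ('X_[strand_mon a] *+ (strand_gen a == b)).
transitivity (\sum_b L (W b * p b)).
  under [RHS]eq_bigr => b _ do rewrite mulr_suml raddf_sum.
  rewrite exchange_big; apply: eq_bigr => a _.
  rewrite (bigD1 (strand_gen a)) //= big1 ?addr0 => [|b neq_b].
    by rewrite eqxx mulr1n -scalerAl LZ mxE.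
  by rewrite eq_sym (negbTE neq_b) mulr0n scaler0 mul0r raddf0.
rewrite raddf_sum; apply: eq_bigr => b _; apply/eqP.
rewrite -subr_eq0 -raddfB -mulrBl L0 // => u.
rewrite mcoeffB strand_part_coef; case: (_ =P d%:Z - _) => [_ | /eqP //].
by rewrite subrr eqxx.
Qed.

Lemma strand_unpack_diff i (U : 'rV[A]_(gf_rank F i.+1)) :
  strand_unpack (U *m gf_diff F i) = strand_unpack U *m gf_diff strand i.
Proof.
apply/rowP=> a; rewrite [RHS]mxE [LHS]mxE.
under eq_bigr => a' _ do rewrite [gf_diff strand i _ _]mxE rmorphM /= split_poly_wmon.
rewrite (strand_unpack_sum (L := mcoeff (strand_mon a))
  (p := fun b => theta (gf_diff F i b (strand_gen a)))).
- rewrite mxE (raddf_sum theta); congr (_@_ _); apply: eq_bigr => b _.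
  exact: rmorphM.
- by move=> c q; rewrite /= mcoeffZ.
move=> b q hq /=; rewrite mcoeffM big1 // => -[u1 u2] /= /eqP def_u.
have [->|/hq/eqP] := eqVneq q@_u1 0; first by rewrite mul0r.
have [->|] := eqVneq (theta (gf_diff F i b (strand_gen a)))@_u2 0.
  by rewrite mulr0.
move=> /(split_poly_deg (resolution_diff_homog resF b (strand_gen a)))/= deg2 [].
have: (mdeg u1)%:Z + (mdeg u2)%:Z = d%:Z - (gf_shift (strand_gen a)).2.
  by rewrite -mdeg_strand_mon -PoszD -mdegD -def_u.
rewrite deg2 addrA => /addIr <-.
by rewrite addrK.
Qed.

(** [V] is the element of F_i, in the original ring, with coordinates [v] in the
    basis of the strand. *)
Definition strand_packed i (V : 'rV[A]_(gf_rank F i)) (v : 'rV[R]_(strand_rank i)) :=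
  map_mx theta V = map_mx (@mpolyC k.+1 R) v *m strand_pack i.

Lemma strand_packed_ex i (v : 'rV[R]_(strand_rank i)) : exists V, strand_packed V v.
Proof.
have /fin_all_exists[V defV] : forall b, exists p,
    theta p = (map_mx (@mpolyC k.+1 R) v *m strand_pack i) 0 b.
  by move=> b; apply: split_poly_surj.
by exists (\row_b V b); apply/rowP=> b; rewrite -defV !mxE.
Qed.

Lemma strand_packed_inj i V V' (v : 'rV[R]_(strand_rank i)) :
  strand_packed V v -> strand_packed V' v -> V = V'.
Proof.
rewrite /strand_packed => <- eqV; apply/matrixP => a b.
have := congr1 (fun M : 'M[B]_(1, gf_rank F i) => M a b) eqV.
by rewrite /= !map_mx_entry => /split_poly_inj.
Qed.

Lemma strand_packedK i V (v : 'rV[R]_(strand_rank i)) :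
  strand_packed V v -> strand_unpack V = v.
Proof.
move/rowP=> pV; apply/rowP => a; rewrite mxE.
have := pV (strand_gen a); rewrite mxE => ->; rewrite mxE raddf_sum /=.
rewrite (bigD1 a) //= big1 ?addr0 => [|a' neq_a].
  by rewrite !mxE mul_mpolyC mcoeffZ mcoeffMn mcoeffX !eqxx mulr1.
rewrite !mxE mul_mpolyC mcoeffZ mcoeffMn mcoeffX.
case: (_ =P strand_mon a) => [eqm|_]; last by rewrite mul0rn mulr0.
case: (_ =P strand_gen a) => [eqg|_]; last by rewrite mulr0n mulr0.
by rewrite (strand_index_inj eqg eqm) eqxx in neq_a.
Qed.

Lemma strand_packed_diff i U (u : 'rV[R]_(strand_rank i.+1)) :
  strand_packed U u -> strand_packed (U *m gf_diff F i) (u *m gf_diff strand i).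
Proof.
move=> pU; rewrite /strand_packed map_mxM pU map_mxM -!mulmxA; congr (_ *m _).
apply/matrixP=> a b; rewrite !mxE (bigD1 (strand_gen a)) //=.
rewrite big1 ?addr0 => [|b' neq]; last first.
  by rewrite !mxE eq_sym (negbTE neq) mulr0n mul0r.
rewrite !mxE eqxx mulr1n -split_poly_wmon -rmorphM /=.
set p := _ * _.
have -> : theta p = \sum_(a' < strand_rank i)
    (theta p)@_(strand_mon a') *: ('X_[strand_mon a'] *+ (strand_gen a' == b)).
  apply/mpolyP => u'; rewrite strand_part_coef.
  have [->|] := eqVneq (theta p)@_u' 0; first by rewrite mul0rn.
  by move/(split_poly_deg (strand_diff_entry_homog a b)) => /= ->; rewrite eqxx.
apply: eq_bigr => a' _; rewrite !mxE mul_mpolyC.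
by case: eqP => [->|_] //; rewrite !mulr0n !scaler0.
Qed.

Lemma strand_packed_aug V (v : 'rV[R]_(strand_rank 0)) : strand_packed V v ->
  rees_map f ((V *m gf_aug F) 0 0) = (v *m gf_aug strand) 0 0 *: 'X^d.
Proof.
move=> pV; rewrite rees_mapE.
have -> : theta ((V *m gf_aug F) 0 0)
    = (map_mx theta V *m map_mx theta (gf_aug F)) 0 0 by rewrite -map_mxM map_mx_entry.
rewrite pV -mulmxA mxE (raddf_sum ev) [in RHS]mxE scaler_suml.
apply: eq_bigr => a _ /=; rewrite [in RHS]mxE map_mx_entry mul_mpolyC.
rewrite {1}/rees_eval mmapZ -/(ev _) mul_polyC -scalerA; congr (_ *: _).
rewrite mxE (bigD1 (strand_gen a)) //= big1 ?addr0 => [|b neq]; last first.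
  by rewrite !mxE eq_sym (negbTE neq) mulr0n mul0r.
rewrite !mxE eqxx mulr1n -split_poly_wmon -rmorphM /=.
by apply: rees_eval_homog => u /(split_poly_deg (strand_aug_entry_homog a)) [].
Qed.

(** A boundary of [F] lying in the strand is a boundary of the strand: project
    a preimage. *)
Lemma strand_packed_image i V (v : 'rV[R]_(strand_rank i)) : strand_packed V v ->
  (exists u, v = u *m gf_diff strand i) <-> (exists U, V = U *m gf_diff F i).
Proof.
move=> pV; split=> [[u def_v] | [U def_V]].
  have [U pU] := strand_packed_ex u; exists U.
  by apply: strand_packed_inj pV _; rewrite def_v; apply: strand_packed_diff.
exists (strand_unpack U).
by rewrite -strand_unpack_diff -def_V (strand_packedK pV).
Qed.

Lemma strand_packed0 i V : strand_packed V (0 : 'rV[R]_(strand_rank i)) <-> V = 0.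
Proof.
have p0 : strand_packed 0 (0 : 'rV[R]_(strand_rank i)).
  by rewrite /strand_packed !map_mx0 mul0mx.
by split=> [pV | ->//]; apply: strand_packed_inj pV p0.
Qed.

(** Taking components of w-degree [d] is exact. *)
Lemma strand_resolution :
  graded_resolution (@std_wt N) (ideal_exp (ideal_gen f) d) (fun p => p = 0) strand.
Proof.
case: (resF) => haug hdiff surj ex0 exS; split.
- move=> a; rewrite mxE coef_rees_eval; apply: whomog_sum => u /eqP deg_u.
  have := whomog_gen_mon hf u; rewrite deg_u; apply: whomogM.
  exact: split_poly_homog (strand_aug_entry_homog a).
- move=> i a b; rewrite mxE /= opprD addrACA subrr addr0.
  exact: split_poly_homog (strand_diff_entry_homog a (strand_gen b)).
- move=> p; split=> [/ideal_rees_eval[q def_q] | [v]]; last first.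
    move/eqP; rewrite subr_eq0 => /eqP->; have [V pV] := strand_packed_ex v.
    have := strand_packed_aug pV; rewrite rees_mapE.
    move/(congr1 (fun P : {poly R} => P`_d)).
    by rewrite coefZ coefXn eqxx mulr1 => <-; apply: coef_rees_eval_ideal.
  have [q' def_q'] := split_poly_surj q.
  case: (surj q') => /(_ I)[V]; rewrite /rees_ideal rees_mapE rmorphB rmorphB /=.
  move/eqP; rewrite subr_eq0 def_q' def_q => /eqP eqV _.
  exists (strand_unpack V); apply/eqP; rewrite subr_eq0; apply/eqP.
  have -> : p = (ev (theta ((V *m gf_aug F) 0 0)))`_d.
    by rewrite -eqV coefZ coefXn eqxx mulr1.
  rewrite [RHS]mxE; under eq_bigr => a _ do
    rewrite [gf_aug strand _ _]mxE rmorphM /= split_poly_wmon.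
  rewrite (strand_unpack_sum (L := coefp d \o ev)
    (p := fun b => theta (gf_aug F b 0))) /=.
  + rewrite mxE (raddf_sum theta); congr (ev _)`_d.
    by apply: eq_bigr => b _; apply: rmorphM.
  + by move=> c x; rewrite /= {1}/rees_eval mmapZ mul_polyC coefZ.
  move=> b x hx; apply: coef_rees_eval0 => u; apply: contraNneq => deg_u.
  rewrite mcoeffM big1 // => -[u1 u2] /= /eqP def_u.
  have [->|/hx/eqP] := eqVneq x@_u1 0; first by rewrite mul0r.
  have [->|] := eqVneq (theta (gf_aug F b 0))@_u2 0; first by rewrite mulr0.
  move/(split_poly_deg (haug b)) => deg2 [].
  have deg_d : (d = mdeg u1 + mdeg u2)%N by rewrite -mdegD -def_u.
  by rewrite -deg2 deg_d PoszD addrK.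
- move=> v; have [V pV] := strand_packed_ex v.
  have eqQ : rees_ideal f ((V *m gf_aug F) 0 0) <-> (v *m gf_aug strand) 0 0 = 0.
    rewrite /rees_ideal (strand_packed_aug pV); split=> [|->]; last by rewrite scale0r.
    move/(congr1 (fun P : {poly R} => P`_d)).
    by rewrite coefZ coefXn eqxx mulr1 coef0.
  apply: iff_trans (iff_sym eqQ) (iff_trans (ex0 V) (iff_sym _)).
  exact: strand_packed_image pV.
move=> i v; have [V pV] := strand_packed_ex v.
have eqQ : V *m gf_diff F i = 0 <-> v *m gf_diff strand i = 0.
  have pVd := strand_packed_diff pV; split=> eq0.
    rewrite -(strand_packedK pVd) eq0; apply/rowP => a.
    by rewrite !mxE raddf0 mcoeff0.
  by apply/strand_packed0; rewrite -eq0.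
apply: iff_trans (iff_sym eqQ) (iff_trans (exS i V) (iff_sym _)).
exact: strand_packed_image pV.
Qed.

End Strand.

(** * Counting basis elements and monomials *)
Section RankOfDiag.
Variable K : fieldType.

Lemma rank_diag_pred_le n (P : pred 'I_n) :
  (\rank (diag_mx (\row_a (P a)%:R) : 'M[K]_n) <= #|P|)%N.
Proof.
have -> : diag_mx (\row_a (P a)%:R) = \sum_(a | P a) delta_mx a a :> 'M[K]_n.
  rewrite [LHS](diag_mx_sum_delta) [RHS]big_mkcond; apply: eq_bigr => a _.
  by rewrite mxE; case: (P a); rewrite ?scale1r ?scale0r.
rewrite -sum1_card; elim/big_rec2: _ => [|a m M _ le_m]; first by rewrite mxrank0.
by apply: leq_trans (mxrank_add _ _) _; rewrite mxrank_delta leq_add2l.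
Qed.

(** The upper bound, applied to [P] and to its complement, is forced to be an
    equality because the two projections add up to the identity. *)
Lemma rank_diag_pred n (P : pred 'I_n) :
  \rank (diag_mx (\row_a (P a)%:R) : 'M[K]_n) = #|P|.
Proof.
apply/eqP; rewrite eqn_leq rank_diag_pred_le /=.
have := mxrank_add (diag_mx (\row_a (P a)%:R) : 'M[K]_n)
                   (diag_mx (\row_a (predC P a)%:R)).
have -> : diag_mx (\row_a (P a)%:R) + diag_mx (\row_a (predC P a)%:R) = 1%:M :> 'M[K]_n.
  apply/matrixP=> a b; rewrite !mxE /= -mulrnDl; congr (_ *+ _).
  by case: (P a); rewrite ?addr0 ?add0r.
rewrite mxrank1 => le_n; rewrite -(leq_add2r #|predC P|) cardC card_ord.
by apply: leq_trans le_n _; rewrite leq_add2l rank_diag_pred_le.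
Qed.

End RankOfDiag.

Lemma mcoeffXM_neq0 (T : nzRingType) n (m m' : 'X_{1..n}) (p : {mpoly T[n]}) :
  ('X_[m] * p)@_m' != 0 -> (m <= m')%MM.
Proof.
rewrite -mcoeff_msupp -commr_mpolyX (perm_mem (msuppMX _ _)).
by case/mapP=> m1 _ ->; apply: lem_addr.
Qed.

Lemma mcoeffXM (T : nzRingType) n (m : 'X_{1..n}) (p : {mpoly T[n]}) :
  ('X_[m] * p)@_m = p@_0%MM.
Proof. by rewrite -commr_mpolyX -(mcoeffMX p m) addm0. Qed.

Lemma card_bmultinom_mdeg_le W k e :
  (#|[pred u : 'X_{1..k.+1 < W} | mdeg (bmnm u) == e]| <= 'C(e + k, e))%N.
Proof.
rewrite -size_basis cardE -(size_map val); apply: uniq_leq_size.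
  by rewrite map_inj_uniq ?enum_uniq //; apply: val_inj.
by move=> m /mapP[u]; rewrite mem_enum inE => deg_u ->; rewrite -basis_cover.
Qed.

(** * Tor of the Rees algebra in negative degrees *)
Section ReesDegrees.
Variables (K : fieldType) (N k : nat).

Lemma whomog_rees_neg (g : int * int) (p : {mpoly K[N + k.+1]}) :
  whomog (@rees_wt N k) g p -> g.2 < 0 -> p = 0.
Proof.
move=> /whomogP hp g_neg; apply/mpolyP => m; rewrite mcoeff0; apply/eqP.
apply: contraTT g_neg => /hp <-; have [v [u ->]] := mcat_ex m.
by rewrite wdeg_mcat -leNgt.
Qed.

(** Variables have nonnegative degrees, so the basis elements of negative
    w-degree span a subcomplex of [F], and the Rees algebra has no elements of
    negative w-degree: the identity is null-homotopic on this subcomplex. *)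
Lemma tor_dim_rees_neg f (F : graded_free K (N + k.+1) (int * int)%type) i j m :
    graded_resolution (@rees_wt N k) (fun _ => True) (rees_ideal f) F ->
  m < 0 -> tor_dim F i (j, m) = 0%N.
Proof.
move=> resF m_neg; apply: (tor_dim_eq0_of_degrees resF (S := fun g => g.2 < 0)) => //.
  move=> i' a b neq0 a_neg; rewrite ltNge; apply: contraNN neq0 => b_ge0.
  rewrite (whomog_rees_neg (resolution_diff_homog resF a b)) //=.
  by rewrite subr_lt0; apply: lt_le_trans a_neg b_ge0.
move=> a a_neg; case: (resF) => haug _ _ _ _; rewrite (whomog_rees_neg (haug a)) //.
exact: resolution_Q0 resF.
Qed.

End ReesDegrees.

(** * Tor of a strand *)
Section StrandRanks.
Variables (K : fieldType) (N k r : nat) (f : 'I_k.+1 -> {mpoly K[N]}).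
Hypothesis hf : forall a, f a \is r.-homog.
Variables (F : graded_free K (N + k.+1) (int * int)%type) (d : nat).
Hypothesis resF :
  graded_resolution (@rees_wt N k) (fun _ => True) (rees_ideal f) F.
Local Notation T := (strand r f F d).
Local Notation smon := (@strand_mon K N k F d _).
Local Notation sgen := (@strand_gen K N k F d _).
Local Notation tdeg j := (j + (r * d)%N%:Z)%R.

Lemma res_diff_strandE i (a : 'I_(gf_rank T i.+1)) (b : 'I_(gf_rank T i)) :
  res_diff T i a b
    = (wmon K N (smon a) * gf_diff F i (sgen a) (sgen b))@_(mcat 0 (smon b)).
Proof. by rewrite map_mx_entry [gf_diff T _ _ _]mxE mcoeff_split_poly. Qed.

Lemma res_diff_strand_diag i (a : 'I_(gf_rank T i.+1)) (b : 'I_(gf_rank T i)) :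
  smon a = smon b -> res_diff T i a b = res_diff F i (sgen a) (sgen b).
Proof. by rewrite res_diff_strandE => ->; rewrite mcoeffXM map_mx_entry. Qed.

(** Modulo x, the coefficient of w^u' e_b' in w^u d(e_b) vanishes unless
    u divides u'. *)
Lemma res_diff_strand_triangular i (a : 'I_(gf_rank T i.+1)) (b : 'I_(gf_rank T i)) :
  res_diff T i a b != 0 -> smon a = smon b \/ (mdeg (smon a) < mdeg (smon b))%N.
Proof.
rewrite res_diff_strandE => /mcoeffXM_neq0/mcat_le le_ab.
have def_b := submK le_ab; rewrite ltnNge.
case: leqP => [le_deg | _]; last by right.
left; move: le_deg; rewrite -def_b mdegD -[leqRHS]add0n leq_add2r leqn0.
by rewrite mdeg_eq0 => /eqP ->; rewrite add0m.
Qed.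

(** Modulo x, the differential of the strand is block triangular for the
    monomials [u], and its diagonal block at [u] is the differential of F modulo
    all variables, in w-degree d - |u|. *)
Lemma strand_boundary_rank W i (j : int) :
  (\sum_(u : 'X_{1..k.+1 < W}) boundary_rank F i (j, (d%:Z - (mdeg (bmnm u))%:Z)%R)
    <= boundary_rank T i (tdeg j))%N.
Proof.
have tri a b : (res_diff T i *m res_comp T i (tdeg j)) a b != 0 ->
    smon a = smon b \/ (mdeg (smon a) < mdeg (smon b))%N.
  rewrite mul_mx_diag mxE => neq0; apply: res_diff_strand_triangular.
  by apply: contraNneq neq0 => ->; rewrite mul0r.
apply: leq_trans (rank_block_triangular (lab := val) val_inj tri).
apply: leq_sum => u _; set M := \matrix_(a, b) _; set g := (j, _).
(* The embedding e_b |-> w^u e_b, zero on the e_b for which w^u e_b is not in the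
   strand. *)
pose X i' : 'M[K]_(gf_rank F i', gf_rank T i') :=
  \matrix_(b, a) ((sgen a == b) && (smon a == val u))%:R.
rewrite /boundary_rank.
suff -> : res_diff F i *m res_comp F i g = X i.+1 *m M *m (X i)^T.
  by apply: leq_trans (mxrankM_maxl _ _) (mxrankM_maxr _ _).
have ME a b c e : sgen a = c -> smon a = val u -> sgen b = e -> smon b = val u ->
    M a b = res_diff F i c e *+ (gf_shift e == g).
  move=> <- mona <- monb; rewrite mxE mona monb eqxx mulr1n mul_mx_diag mxE.
  rewrite res_diff_strand_diag ?mona // [X in _ * X]mxE mulr_natr; congr (_ *+ _).
  rewrite /= (inj_eq (addIr _)) /g -pair_eqE /= -monb mdeg_strand_mon.
  by rewrite subKr eqxx andbT.
have sumX i' (c : 'I_(gf_rank F i')) :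
    (gf_shift c).2 = d%:Z - (mdeg (val u))%:Z -> \sum_a X i' c a = 1.
  move=> shift_c; have [a [gen_a mon_a]] :
      exists a : 'I_(gf_rank T i'), sgen a = c /\ smon a = val u.
    by apply: strand_index_ex; rewrite shift_c subKr.
  rewrite (bigD1 a) //= big1 ?addr0 => [|a' neq_a].
    by rewrite mxE gen_a mon_a !eqxx.
  rewrite mxE; case: andP => // -[/eqP gen_a' /eqP mon_a'].
  by case/eqP: neq_a; apply: strand_index_inj; rewrite ?gen_a ?mon_a.
apply/matrixP=> c e; rewrite mul_mx_diag.
have -> : (X i.+1 *m M *m (X i)^T) c e
    = (res_diff F i c e *+ (gf_shift e == g)) * (\sum_a X _ c a) * (\sum_b X _ e b).
  rewrite mxE mulr_sumr; apply: eq_bigr => b _.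
  rewrite mxE !mulr_suml mulr_sumr mulr_suml; apply: eq_bigr => a _.
  rewrite [_^T _ _]mxE [X i.+1 c a]mxE [X i e b]mxE.
  have [/andP[/eqP gen_a /eqP mon_a] | _] := boolP (_ && (smon a == _)); last first.
    by rewrite mul0r mulr0 !mul0r.
  have [/andP[/eqP gen_b /eqP mon_b] | _] := boolP (_ && (smon b == _)); last first.
    by rewrite !mulr0.
  by rewrite (ME a b c e) // mul1r !mulr1.
rewrite mxE [X in _ * X = _]mxE.
have [eq_e | _] := eqVneq (gf_shift e) g; last by rewrite mulr0 mulr0n !mul0r.
have [-> | Dn0] := eqVneq (res_diff F i c e) 0; first by rewrite mul0rn !mul0r.
rewrite !sumX ?eq_e ?mulr1 //.
move: Dn0; rewrite map_mx_entry.
move/(whomog_mcoeff0 (resolution_diff_homog resF c e))/eqP.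
by rewrite subr_eq0 eq_e => /eqP ->.
Qed.

Lemma strand_coboundary_rank W i (j : int) :
  (\sum_(u : 'X_{1..k.+1 < W}) coboundary_rank F i (j, (d%:Z - (mdeg (bmnm u))%:Z)%R)
    <= coboundary_rank T i (tdeg j))%N.
Proof.
by case: i => [|i]; [rewrite big1 | apply: strand_boundary_rank].
Qed.

Lemma strand_comp_rank i (j : int) :
  (\rank (res_comp T i (tdeg j))
    <= \sum_(u : 'X_{1..k.+1 < strand_bound F d i})
         \rank (res_comp F i (j, (d%:Z - (mdeg (bmnm u))%:Z)%R)))%N.
Proof.
under eq_bigr => u _ do rewrite /res_comp
  (rank_diag_pred _ (fun b : 'I_(gf_rank F i) =>
     gf_shift b == (j, (d%:Z - (mdeg (bmnm u))%:Z)%R))).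
rewrite /res_comp (rank_diag_pred _ (fun a : 'I_(gf_rank T i) => gf_shift a == tdeg j)).
rewrite -sum1_card (partition_big (fun a => (enum_val a).2) predT) //=.
apply: leq_sum => u _; rewrite sum1_card.
rewrite -(card_in_imset (f := @strand_gen K N k F d i)); last first.
  move=> a a'; rewrite !unfold_in => /andP[_ /eqP eq_u] /andP[_ /eqP eq_u'] eq_gen.
  by apply: strand_index_inj; rewrite // /strand_mon eq_u eq_u'.
apply: subset_leq_card; apply/subsetP => b /imsetP[a].
rewrite !unfold_in /= (inj_eq (addIr _)) => /andP[/eqP shift_a /eqP eq_u] ->.
rewrite -pair_eqE /= shift_a eqxx /= -eq_u -/(strand_mon a) mdeg_strand_mon.
by rewrite subKr.
Qed.

(** The numbers of basis elements add up over the blocks, while the ranks of the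
    differentials are at least the sums over the blocks. *)
Lemma tor_dim_strand_leq i (j : int) :
  (tor_dim T i (tdeg j)
    <= \sum_(u : 'X_{1..k.+1 < strand_bound F d i})
         tor_dim F i (j, (d%:Z - (mdeg (bmnm u))%:Z)%R))%N.
Proof.
have resT := strand_resolution hf d resF.
rewrite -(leq_add2r (boundary_rank T i (tdeg j) + coboundary_rank T i (tdeg j))).
rewrite (tor_dimE resT); apply: leq_trans (strand_comp_rank i j) _.
under eq_bigr => u _ do rewrite -(tor_dimE resF).
rewrite big_split leq_add2l big_split; apply: leq_add.
  exact: strand_boundary_rank.
exact: strand_coboundary_rank.
Qed.

(** There are binomial (d - m + k, d - m) monomials [u] of degree d - m, and the
    [u] of degree greater than [d] meet Tor in negative degrees only. *)
Lemma sum_tor_dim_rees_leq W i (j : int) :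
  (\sum_(u : 'X_{1..k.+1 < W}) tor_dim F i (j, (d%:Z - (mdeg (bmnm u))%:Z)%R)
    <= \sum_(m < d.+1) 'C(d + k - m, d - m) * tor_dim F i (j, (m : nat)%:Z))%N.
Proof.
rewrite (bigID (fun u : 'X_{1..k.+1 < W} => (mdeg (bmnm u) <= d)%N)) /= addnC.
rewrite big1 => [|u]; last first.
  rewrite -ltnNge => lt_d; apply: (tor_dim_rees_neg _ _ resF).
  by rewrite subr_lt0 ltz_nat.
rewrite add0n (partition_big (fun u => inord (d - mdeg (bmnm u)) : 'I_d.+1) predT) //=.
apply: leq_sum => m _; have le_m : (m <= d)%N by rewrite -ltnS.
rewrite (eq_bigr (fun=> tor_dim F i (j, (m : nat)%:Z))); last first.
  move=> u /andP[le_u /eqP <-].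
  by rewrite inordK ?ltnS ?leq_subr // subzn.
rewrite sum_nat_const leq_mul2r; apply/orP; right.
rewrite addnC -addnBA // addnC; apply: leq_trans (card_bmultinom_mdeg_le W _ _).
apply: subset_leq_card; apply/subsetP => u; rewrite !inE => /andP[le_u /eqP <-].
by rewrite inordK ?ltnS ?leq_subr // subKn.
Qed.

End StrandRanks.

Theorem theorem1p6 (K : fieldType) (N k r : nat)
    (f : 'I_k.+1 -> {mpoly K[N]}) (hf : forall a, f a \is r.-homog)
    (* a bigraded free resolution of the Rees algebra S / L over S *)
    (FR : graded_free K (N + k.+1) (int * int)%type)
    (hFR : graded_resolution (@rees_wt N k) (fun _ => True) (rees_ideal f) FR)
    (d : nat)
    (* a graded free resolution of I ^ d over R *)
    (FI : graded_free K N int)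
    (hFI : graded_resolution (@std_wt N) (ideal_exp (ideal_gen f) d)
             (fun p => p = 0) FI)
    (i : nat) (j : int) :
  (tor_dim FI i (j + (r * d)%N%:Z)
     <= \sum_(m < d.+1)
          'C(d + k - m, d - m) * tor_dim FR i (j, (m : nat)%:Z))%N.
Proof.
apply: leq_trans (tor_dim_resolution_leq i _ hFI (strand_resolution hf d hFR)) _.
apply: leq_trans (tor_dim_strand_leq hf d hFR i j) _.
exact: sum_tor_dim_rees_leq hFR _ _ _.
Qed.
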